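(* Let $W=\sum_{i=1}^n\mathbb{I}_i$ be the sum of $n$ independent Bernoulli random variables with success probabilities $p_i$, $q_i=1-p_i$, and let $M,\delta,p,\alpha$, $\mathrm{BCP}$, $\widehat\lambda,\sigma^2,\tau,\theta_1$ be as defined in the context. If $\max(p,\theta_1)<1/2$ and $\sigma^2>3\tau$, then $$\|\mathcal{L}(W)-\mathrm{BCP}\|_{TV}\le\frac{2}{(1-2\theta_1)\widehat\lambda}\Big\{\frac{2\sum_{i=1}^np_i^4}{\sqrt{(\sigma^2-\tau)(\sigma^2-3\tau)}}+\frac{2Mp^4}{(1-2p)^2\,\sigma\sqrt{\sigma^2-\tau}}+(1+2p)\delta p^2\Big\}.$$
   Context: Total variation norm: for a finite signed measure $\nu$ on $\mathbb{Z}$, $\|\nu\|_{TV}=\sum_{k\in\mathbb{Z}}|\nu\{k\}|$ (twice the usual total variation metric for differences of probability laws). $\mathcal{L}(X)$ is the law of $X$. Not all $p_i$ are zero. Parameters: $M=\big\lfloor(\sum_{i=1}^np_i^2)^3(\sum_{i=1}^np_i^3)^{-2}\big\rfloor$, $\ \delta=(\sum_{i=1}^np_i^2)^3(\sum_{i=1}^np_i^3)^{-2}-M\in[0,1)$, $\ p=(\sum_{i=1}^np_i^3)(\sum_{i=1}^np_i^2)^{-1}$, $\ \alpha=\sum_{i=1}^np_i-Mp$, $\ q=1-p$. $\mathrm{BCP}$ denotes the law of $Y_1+Y_2$ with $Y_1$ Poisson with mean $\alpha$ and $Y_2\sim Bi(M,p)$ independent, i.e. the law with probability generating function $(q+pz)^M\exp\{\alpha(z-1)\}$.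 $\widehat\lambda=\sum_{i=1}^np_i$, $\ \sigma^2=\sum_{i=1}^np_iq_i$ ($\sigma\ge 0$), $\ \tau=\max_ip_iq_i$, and $$\theta_1=\frac{Mp^2}{(1-2p)^2(Mp+\alpha)}=\frac{\sum_{i=1}^np_i^2-\delta p^2}{(1-2p)^2\sum_{i=1}^np_i}.$$ *)

(* Defs.v *)
From HB Require Import structures.
From mathcomp Require Import all_boot all_order all_algebra.
From mathcomp Require Import all_classical all_reals all_analysis.
From mathcomp Require Import measurable_realfun.

Set Implicit Arguments.
Unset Strict Implicit.
Unset Printing Implicit Defensive.

Import Order.TTheory GRing.Theory Num.Theory.
Import numFieldNormedType.Exports.

Local Open Scope classical_set_scope.
Local Open Scope ring_scope.

(* Discrete sigma-algebra on the integers, as the library has it on [nat]. *)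
HB.instance Definition _ := isPointed.Build int 0.
HB.instance Definition _ := @isMeasurable.Build default_measure_display
  int discrete_measurable discrete_measurable0
  discrete_measurableC discrete_measurableU.

Definition tv_norm (R : realType) (nu : {charge set int -> \bar R}) : \bar R :=
  \esum_(k in [set: int]) `|nu [set k]|%E.

(* The signed measure mu1 - mu2. *)
Definition prob_diff (R : realType) (mu1 mu2 : probability int R) :
    {charge set int -> \bar R} :=
  cadd (charge_of_finite_measure mu1) (copp (charge_of_finite_measure mu2)).

Definition mutually_independent (d d' : measure_display)
    (T : measurableType d) (T' : measurableType d') (R : realType)
    (P : probability T R) (n : nat) (X : 'I_n -> {RV P >-> T'}) : Prop :=
  forall (J : {set 'I_n}) (A : 'I_n -> set T'),
    (forall i, measurable (A i)) ->
    P (\bigcap_(i in [set i | i \in J]) (X i @^-1` A i)) =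
    (\prod_(i in J) P (X i @^-1` A i))%E.

Section indicator_sum.
Context (d : measure_display) (T : measurableType d) (R : realType)
  (P : probability T R) (n : nat) (X : 'I_n -> {RV P >-> bool}).

Definition indicator_sum (t : T) : int := (\sum_(i < n) (X i t : nat))%N%:Z.

Lemma measurable_indicator_sum : measurable_fun [set: T] indicator_sum.
Proof.
apply: (@measurableT_comp _ _ _ _ _ _ Posz _
  (fun t => (\sum_(i < n) (X i t : nat))%N)) => //.
elim: (index_enum 'I_n) => [|i s IH].
  by under eq_fun do rewrite big_nil; exact: measurable_cst.
under eq_fun do rewrite big_cons.
apply: measurable_fun_addn IH.
exact: (@measurableT_comp _ _ _ _ _ _ nat_of_bool _ (X i)).
Qed.

HB.instance Definition _ :=
  isMeasurableFun.Build _ _ _ _ indicator_sum measurable_indicator_sum.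

End indicator_sum.

Definition nat_pair_sum (y : nat * nat) : int := (y.1 + y.2)%N%:Z.

Lemma measurable_nat_pair_sum : measurable_fun [set: nat * nat] nat_pair_sum.
Proof.
apply: (@measurableT_comp _ _ _ _ _ _ Posz _ (fun y => (y.1 + y.2)%N)) => //.
exact: measurable_fun_addn.
Qed.

HB.instance Definition _ :=
  isMeasurableFun.Build _ _ _ _ nat_pair_sum measurable_nat_pair_sum.

(* Law of Y1 + Y2 for independent Y1 ~ Poisson(alpha) and Y2 ~ Bi(M, p).  The
   second argument of [poisson_prob] is ignored by the library's definition,
   and [poisson_prob] with rate 0 is the Dirac mass at 0. *)
Definition bcp (R : realType) (alpha : R) (M : nat) (p : R) :
    probability int R :=
  distribution (poisson_prob alpha 0%N \x binomial_prob M p)%E nat_pair_sum.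

Section parameters.
Context (R : realType) (n : nat) (ps : 'I_n -> R).

Definition power_sum (k : nat) : R := \sum_(i < n) ps i ^+ k.

Definition bcp_ratio : R := power_sum 2 ^+ 3 / power_sum 3 ^+ 2.

(* [Num.truncn] is the floor, as a natural number, of a nonnegative real. *)
Definition bcp_M : nat := Num.truncn bcp_ratio.

Definition bcp_delta : R := bcp_ratio - bcp_M%:R.

Definition bcp_p : R := power_sum 3 / power_sum 2.

Definition lambda_hat : R := \sum_(i < n) ps i.

Definition bcp_alpha : R := lambda_hat - bcp_M%:R * bcp_p.

Definition sigma2 : R := \sum_(i < n) ps i * (1 - ps i).

(* The terms are nonnegative when [0 <= ps i <= 1], so starting the maximum at
   0 is harmless as soon as [0 < n]. *)
Definition tau : R := \big[Num.max/0]_(i < n) (ps i * (1 - ps i)).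

Definition theta1 : R :=
  bcp_M%:R * bcp_p ^+ 2 /
  ((1 - 2 * bcp_p) ^+ 2 * (bcp_M%:R * bcp_p + bcp_alpha)).

End parameters.

(* Main.v *)
(* Write Y for a BCP variable, W_i = W - I_i, D u(k) = u(k+1) - u(k).  Let G
   solve the Poisson Stein equation lam G(k) - k G(k-1) = f(k) - c, where f is
   the sign of P(W = k) - P(Y = k); then |D G| <= 2 / lam.  With
   (1 + p D) H = G, the BCP law satisfies
   E Y G(Y-1) = alpha E G(Y) + M p E H(Y), a perturbation of the Poisson
   identity, so the distance equals
   sum_i p_i^2 E D G(W_i) - M p^2 E D H(Y).
   Replacing Y by W costs at most M p^2 |D H| times the distance, which is
   absorbed in the left-hand side (factor 1 - 2 theta1).  Expanding around W,
   the first two orders match up to delta, and what remains are the third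
   differences E D^3 G(W_i) and E D^3 H(W).

   For these, put xi_i = I_i - p_i: for i <> j, p_i q_i p_j q_j E D^2 u(W) is
   E xi_i xi_j (q_i q_j u(W) + (q_i p_j + p_i q_j) u(W+1) + p_i p_j u(W+2)).
   Summing over i <> j gives three degenerate U-statistics, bounded in L^1 by
   their explicit L^2 norms.  The constant obtained is good enough because
   p < 1/2 prevents the p_i close to 1 from carrying much of the variance. *)

Require Import Defs.
From HB Require Import structures.
From mathcomp Require Import all_boot all_order all_algebra.
From mathcomp Require Import all_classical all_reals all_analysis.
From mathcomp Require Import ring lra.

Set Implicit Arguments.
Unset Strict Implicit.
Unset Printing Implicit Defensive.

Import Order.TTheory GRing.Theory Num.Theory.
Import numFieldNormedType.Exports.

Local Open Scope ring_scope.

(** * Expectations over independent Bernoulli variables *)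

Definition bernoulli_variance {R : pzRingType} {I : Type} (p : I -> R) i : R :=
  p i * (1 - p i).

Definition moment_sum {R : pzSemiRingType} {I : finType} (p : I -> R) k : R :=
  \sum_i p i ^+ k.

Section bernoulli_product.
Context {R : realFieldType} {I : finType} (p : I -> R).

Implicit Types (A : {set I}) (w : {ffun I -> bool}) (i j k l : I) (b : bool)
  (F G : {ffun I -> bool} -> R).

(** Expectations are finite sums over the cube of outcomes; the given probability space enters only
    through [indicator_sum_set1]. *)
Definition weight (w : {ffun I -> bool}) : R :=
  \prod_i (if w i then p i else 1 - p i).

Definition expect (F : {ffun I -> bool} -> R) : R := \sum_w weight w * F w.

Definition upd (w : {ffun I -> bool}) (i : I) (b : bool) : {ffun I -> bool} :=
  [ffun j => if j == i then b else w j].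

Definition cnt (A : {set I}) (w : {ffun I -> bool}) : nat :=
  (\sum_(i in A) w i)%N.

Definition centered (i : I) (w : {ffun I -> bool}) : R := (w i)%:R - p i.

Lemma upd_same w i b : upd w i b i = b.
Proof. by rewrite ffunE eqxx. Qed.

Lemma upd_other w i j b : j != i -> upd w i b j = w j.
Proof. by rewrite ffunE => /negPf ->. Qed.

Lemma cnt_upd_in A w i b : i \in A -> cnt A (upd w i b) = (b + cnt (A :\ i) w)%N.
Proof.
move=> Ai; rewrite /cnt (big_setD1 i Ai) /= upd_same; congr (_ + _)%N.
by apply: eq_bigr => j; rewrite !inE => /andP[ji _]; rewrite upd_other.
Qed.

Lemma centered_upd_same w i b : centered i (upd w i b) = b%:R - p i.
Proof. by rewrite /centered upd_same. Qed.

Lemma centered_upd_other w i j b : j != i ->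
  centered j (upd w i b) = centered j w.
Proof. by move=> ji; rewrite /centered upd_other. Qed.

Lemma eq_expect F G : F =1 G -> expect F = expect G.
Proof. by move=> FG; apply: eq_bigr => w _; rewrite FG. Qed.

Lemma expectD F G : expect (fun w => F w + G w) = expect F + expect G.
Proof. by rewrite -big_split; apply: eq_bigr => w _; rewrite mulrDr. Qed.

Lemma expectZ c F : expect (fun w => c * F w) = c * expect F.
Proof. by rewrite /expect mulr_sumr; apply: eq_bigr => w _; rewrite mulrCA. Qed.

Lemma expectB F G : expect (fun w => F w - G w) = expect F - expect G.
Proof.
rewrite (@eq_expect _ (fun w => F w + -1 * G w)).
  by rewrite expectD expectZ mulN1r.
by move=> w; rewrite mulN1r.
Qed.

Lemma expect_sum (J : Type) (r : seq J) (Q : pred J)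
    (F : J -> {ffun I -> bool} -> R) :
  expect (fun w => \sum_(j <- r | Q j) F j w) = \sum_(j <- r | Q j) expect (F j).
Proof.
by rewrite /expect exchange_big; apply: eq_bigr => w _; rewrite mulr_sumr.
Qed.

(** Conditioning on all coordinates but i. Flipping coordinate i is an involution, so twice each
    side is a sum over outcomes paired with their flips, and the pairs agree one by one. *)
Lemma expect_upd i F : expect F =
  expect (fun w => (1 - p i) * F (upd w i false) + p i * F (upd w i true)).
Proof.
pose flip w := upd w i (~~ w i).
have flipK : involutive flip.
  move=> w; apply/ffunP => j; rewrite /flip !ffunE eqxx.
  by case: eqP => [->|//]; rewrite negbK.
have flip_upd w b : upd (flip w) i b = upd w i b.
  by apply/ffunP => j; rewrite /flip !ffunE; case: eqP.
have weightE w : weight w = (if w i then p i else 1 - p i) *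
    \prod_(j | j != i) (if w j then p j else 1 - p j).
  by rewrite /weight (bigD1 i).
have flip_rest w : \prod_(j | j != i) (if flip w j then p j else 1 - p j) =
    \prod_(j | j != i) (if w j then p j else 1 - p j).
  by apply: eq_bigr => j ji; rewrite /flip upd_other.
have updE w : upd w i (w i) = w.
  by apply/ffunP => j; rewrite ffunE; case: eqP => [->|].
have expect_flip G : expect G + expect G =
    \sum_w (weight w * G w + weight (flip w) * G (flip w)).
  rewrite big_split /=; congr (_ + _).
  by rewrite /expect (reindex_inj (inv_inj flipK)).
suff : expect F + expect F = expect (fun w =>
  (1 - p i) * F (upd w i false) + p i * F (upd w i true)) + expect (fun w =>
  (1 - p i) * F (upd w i false) + p i * F (upd w i true)) by lra.
rewrite !expect_flip; apply: eq_bigr => w _.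
rewrite !weightE flip_rest !flip_upd.
rewrite -[in F w](updE w) -[in F (flip w)](updE (flip w)) flip_upd.
rewrite /flip upd_same; case: (w i) => /=; ring.
Qed.

Lemma expect_cst c : expect (fun=> c) = c.
Proof.
rewrite /expect -mulr_suml; suff -> : \sum_w weight w = 1 by rewrite mul1r.
rewrite -(bigA_distr_bigA (fun i (b : bool) => if b then p i else 1 - p i)).
by apply: big1 => i _; rewrite big_bool /=; ring.
Qed.

Hypothesis p01 : forall i, 0 <= p i <= 1.

Lemma weight_ge0 w : 0 <= weight w.
Proof.
apply: prodr_ge0 => i _; have /andP[] := p01 i; case: (w i) => // *.
by rewrite subr_ge0.
Qed.

Lemma ler_expect F G : (forall w, F w <= G w) -> expect F <= expect G.
Proof. by move=> FG; apply: ler_sum => w _; rewrite ler_wpM2l ?weight_ge0. Qed.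

Lemma expect_ge0 F : (forall w, 0 <= F w) -> 0 <= expect F.
Proof. by move=> F0; rewrite -(expect_cst 0) ler_expect. Qed.

Lemma ler_norm_expect F : `|expect F| <= expect (fun w => `|F w|).
Proof.
apply: le_trans (ler_norm_sum _ _ _) _; apply: ler_sum => w _.
by rewrite normrM ger0_norm ?weight_ge0.
Qed.

(** The variance of [|F|] is nonnegative. *)
Lemma expect_norm_sqr F : expect (fun w => `|F w|) ^+ 2 <= expect (fun w => F w ^+ 2).
Proof.
set m := expect (fun w => `|F w|).
have := @expect_ge0 (fun w => (`|F w| - m) ^+ 2) (fun w => sqr_ge0 _).
rewrite (@eq_expect _ (fun w => (F w ^+ 2 - (2 * m) * `|F w|) + m ^+ 2)).
  by rewrite expectD expect_cst expectB expectZ -/m; nra.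
by move=> w; rewrite -[F w ^+ 2]real_normK ?num_real//; ring.
Qed.

Local Notation v := (bernoulli_variance p).

(* The right-hand side is E xi_i xi_j u(W_A + B_i + B_j) with B_i, B_j fresh
   independent copies of I_i, I_j. *)
Lemma second_difference_expect (A : {set I}) i j (u : nat -> R) :
  i \in A -> j \in A -> i != j ->
  v i * v j * expect (fun w =>
    u (cnt A w).+2 - 2 * u (cnt A w).+1 + u (cnt A w)) =
  expect (fun w => centered i w * centered j w *
    ((1 - p i) * (1 - p j) * u (cnt A w) +
     ((1 - p i) * p j + p i * (1 - p j)) * u (cnt A w).+1 +
     p i * p j * u (cnt A w).+2)).
Proof.
move=> Ai Aj ij; have ji : j != i by rewrite eq_sym.
have Aj' : j \in A :\ i by rewrite !inE ji.
rewrite (expect_upd i) (expect_upd j) [RHS](expect_upd i) [RHS](expect_upd j).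
rewrite -expectZ; apply: eq_expect => w /=.
rewrite !cnt_upd_in// !centered_upd_same.
rewrite !(centered_upd_other _ _ ji) !centered_upd_same.
rewrite /bernoulli_variance !addnA !add0n !add1n /=; ring.
Qed.

Lemma expect_centered0 i F : (forall w b, F (upd w i b) = F w) ->
  expect (fun w => centered i w * F w) = 0.
Proof.
move=> Fi; rewrite (expect_upd i) -(expect_cst 0); apply: eq_expect => w /=.
by rewrite !centered_upd_same !Fi /=; ring.
Qed.

(** Products xi_i xi_j over distinct unordered pairs are orthogonal: an index that occurs only once
    contributes an independent factor of mean zero. *)
Lemma expect_centered4 i j k l : i != j -> k != l ->
  expect (fun w => centered i w * centered j w * (centered k w * centered l w)) =
  v i * v j * (((k == i) && (l == j))%:R + ((k == j) && (l == i))%:R).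
Proof.
move=> ij kl; have ji : j != i by rewrite eq_sym.
have lk : l != k by rewrite eq_sym.
have vanish m F G : (forall w, F w = centered m w * G w) ->
    (forall w b, G (upd w m b) = G w) -> expect F = 0.
  by move=> FE Gm; rewrite (eq_expect FE) expect_centered0.
have square : expect (fun w => centered i w * centered j w *
    (centered i w * centered j w)) = v i * v j.
  rewrite (expect_upd i) (expect_upd j) -[RHS]expect_cst; apply: eq_expect => w /=.
  rewrite !centered_upd_same !(centered_upd_other _ _ ji) !centered_upd_same.
  by rewrite /bernoulli_variance /=; ring.
have [ki|ki] := eqVneq k i; [|have [kj|kj] := eqVneq k j].
- have [lj|lj] := eqVneq l j.
    by rewrite ki lj (negPf ij) square /=; ring.
  rewrite ki (negPf ij) /= !addr0 mulr0.
  apply: (vanish l _ (fun w => centered i w * centered j w * centered i w)) => [w|w b].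
    by ring.
  by rewrite !centered_upd_other// 1?eq_sym// -ki.
- have [li|li] := eqVneq l i.
    rewrite kj li (_ : expect _ = v i * v j).
      by rewrite (negPf ij) /=; ring.
    by rewrite -square; apply: eq_expect => w; ring.
  rewrite /= addr0 mulr0.
  apply: (vanish l _ (fun w => centered i w * centered j w * centered j w)) => [w|w b].
    by rewrite kj; ring.
  by rewrite !centered_upd_other// 1?eq_sym// -kj.
- rewrite /= addr0 mulr0.
  apply: (vanish k _ (fun w => centered i w * centered j w * centered l w)) => [w|w b].
    by ring.
  by rewrite !centered_upd_other// 1?eq_sym.
Qed.

(** In the expanded square only (k, l) = (i, j) and (k, l) = (j, i) survive, and the symmetry of [c]
    makes the two contributions equal. *)
Lemma expect_ustat_sqr (A : {set I}) (c : I -> I -> R) :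
  (forall i j, c i j = c j i) ->
  expect (fun w => (\sum_(i in A) \sum_(j in A | j != i)
      c i j * (centered i w * centered j w)) ^+ 2) =
  2 * \sum_(i in A) \sum_(j in A | j != i) c i j ^+ 2 * (v i * v j).
Proof.
move=> csym.
rewrite (@eq_expect _ (fun w => \sum_(i in A) \sum_(j in A | j != i)
   \sum_(k in A) \sum_(l in A | l != k) c i j * c k l *
   (centered i w * centered j w * (centered k w * centered l w)))); last first.
  move=> w; rewrite expr2 mulr_suml; apply: eq_bigr => i _.
  rewrite mulr_suml; apply: eq_bigr => j _.
  rewrite mulr_sumr; apply: eq_bigr => k _.
  by rewrite mulr_sumr; apply: eq_bigr => l _; ring.
rewrite expect_sum mulr_sumr; apply: eq_bigr => i Ai.
rewrite expect_sum mulr_sumr; apply: eq_bigr => j /andP[Aj ji].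
have ij : i != j by rewrite eq_sym.
rewrite expect_sum.
under eq_bigr => k Ak.
  rewrite expect_sum.
  under eq_bigr => l /andP[Al lk].
    rewrite expectZ expect_centered4//; last by rewrite eq_sym.
    rewrite mulrDr mulrDr.
    over.
  rewrite big_split /=.
  over.
rewrite big_split /=.
rewrite (bigD1 i)//= (bigD1 j) ?Aj ?ji//= !eqxx /= mulr1.
rewrite [X in _ + X + _]big1 => [|k /andP[_ /negPf ki]]; last first.
  by rewrite big1 => // l _; rewrite ki /=; ring.
rewrite [X in _ + X + 0 + _]big1 => [|l /andP[_ /negPf lj]]; last first.
  by rewrite lj /=; ring.
rewrite (bigD1 j)//= (bigD1 i) ?Ai ?ij//= !eqxx /= mulr1.
rewrite [X in _ + (_ + X)]big1 => [|k /andP[_ /negPf kj]]; last first.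
  by rewrite big1 => // l _; rewrite kj /=; ring.
rewrite [X in _ + (_ + X + _)]big1 => [|l /andP[_ /negPf li]]; last first.
  by rewrite li /=; ring.
by rewrite (csym j i); ring.
Qed.

End bernoulli_product.

(** * Smoothing: second differences of the law of W *)

Section smoothing_arithmetic.
Context {R : rcfType}.
Implicit Types (a b m s t e v x tau : R).

(* In the next lemmas a, b and m stand for the sums of v_i q_i^2, v_i p_i^2 and
   v_i p_i q_i, with v_i = p_i q_i, so that a + b + 2 m is the variance. *)
Lemma smoothing_weight_full a b m e : 0 <= a -> 0 <= b -> 0 <= m ->
  0 < e -> e <= 1 -> e * (b + m) <= m ->
  e * (a + Num.sqrt (2 * (a * b) + 2 * m ^+ 2) + b) <= a + b + 2 * m.
Proof.
move=> a0 b0 m0 e0 e1 ebm.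
(* [y] equals a + b + 2 m - e (a + b), written so that its sign is visible; it remains to compare
   squares. *)
pose y := (1 - e) * (a + b + 2 * m) + 2 * e * m.
have y0 : 0 <= y.
  by apply: addr_ge0; apply: mulr_ge0; lra.
have eb : e * b <= (1 - e) * m by lra.
suff : e * Num.sqrt (2 * (a * b) + 2 * m ^+ 2) <= y by rewrite /y; lra.
rewrite -[leLHS]ger0_norm ?mulr_ge0 ?sqrtr_ge0 ?(ltW e0)//.
rewrite -[leRHS]ger0_norm// -ler_sqr ?nnegrE// !real_normK ?num_real//.
rewrite exprMn sqr_sqrtr ?addr_ge0 ?mulr_ge0 ?sqr_ge0//.
have h1 : e * a * (e * b) <= e * a * ((1 - e) * m).
  by apply: ler_wpM2l => //; rewrite mulr_ge0// ltW.
have h2 : 0 <= (1 - e) * m * e * a.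
  by rewrite !mulr_ge0 ?subr_ge0// ltW.
have h3 : 0 <= (1 - e) * m * e * b.
  by rewrite !mulr_ge0 ?subr_ge0// ltW.
have h4 : 0 <= (1 - e) * m * e * m.
  by rewrite !mulr_ge0 ?subr_ge0// ltW.
have h5 : 0 <= ((1 - e) * (a + b + 2 * m)) ^+ 2 by exact: sqr_ge0.
have h6 : 0 <= (e * m) ^+ 2 by exact: sqr_ge0.
rewrite /y; nra.
Qed.

(** With z the root, (a + z + b)^2 is at most 3 (a^2 + z^2 + b^2) = 3 ((a + b)^2 + 2 m^2). No
    comparison of b with m enters. *)
Lemma smoothing_weight_crude a b m : 0 <= a -> 0 <= b -> 0 <= m ->
  a + Num.sqrt (2 * (a * b) + 2 * m ^+ 2) + b <= Num.sqrt 3 * (a + b + 2 * m).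
Proof.
move=> a0 b0 m0.
set z := Num.sqrt _.
have z0 : 0 <= z by exact: sqrtr_ge0.
have z2 : z ^+ 2 = 2 * (a * b) + 2 * m ^+ 2.
  by rewrite sqr_sqrtr// addr_ge0 ?mulr_ge0 ?sqr_ge0.
rewrite -ler_sqr ?nnegrE ?addr_ge0 ?mulr_ge0 ?sqrtr_ge0 ?addr_ge0 ?mulr_ge0//.
rewrite exprMn sqr_sqrtr//.
have h1 : 0 <= (a - z) ^+ 2 by exact: sqr_ge0.
have h2 : 0 <= (b - z) ^+ 2 by exact: sqr_ge0.
have h3 : 0 <= (a - b) ^+ 2 by exact: sqr_ge0.
have h4 : 0 <= m * a by exact: mulr_ge0.
have h5 : 0 <= m * b by exact: mulr_ge0.
have h6 : 0 <= m ^+ 2 by exact: sqr_ge0.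
nra.
Qed.

(** The claim amounts to s^2 - 4 s tau + tau^2 <= 0, that is, tau / s between 2 - sqrt 3 and 2 +
    sqrt 3; 3/11 is a rational just above the lower root. *)
Lemma punctured_large_tau s tau : 0 <= tau -> 3 * tau < s -> 3 / 11 * s <= tau ->
  2 * 3 * ((s - tau) * (s - 3 * tau)) <= 4 * (s - 2 * tau) ^+ 2.
Proof.
move=> tau0 t3 big; rewrite expr2.
have x1 : 0 <= tau - 3 / 11 * s by lra.
have x2 : 0 <= s - 3 * tau by lra.
have s0 : 0 <= s by lra.
by have := mulr_ge0 x1 x2; have := mulr_ge0 s0 x1; have := mulr_ge0 s0 s0; lra.
Qed.

(* The left side is concave in b, with vertex (t - 2 m) / 2. *)
Lemma punctured_quadratic b m t : 0 <= m -> 0 <= t ->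
  b <= m + 3 / 32 * t ->
  2 * ((t - b - 2 * m) * b) + 2 * m ^+ 2 <= (12 / 29 * t + 2 * m) ^+ 2.
Proof.
move=> m0 t0 bm; rewrite !expr2.
have mt : 0 <= m * t by exact: mulr_ge0.
have m2 : 0 <= m * m by exact: mulr_ge0.
have t2 : 0 <= t * t by exact: mulr_ge0.
(* If the largest allowed b lies left of the vertex, the left side is largest there. Otherwise m >
   13/64 t, and the value at the vertex is already small enough. *)
have [ct|ct] := leP (2 * (m + 3 / 32 * t)) (t - 2 * m).
  have x1 : 0 <= m + 3 / 32 * t - b by lra.
  have x2 : 0 <= t - 2 * m - b - (m + 3 / 32 * t) by lra.
  by have := mulr_ge0 x1 x2; lra.
have x : 0 <= 4 * m - 13 / 16 * t by lra.
have h1 := mulr_ge0 x m0; have h2 := mulr_ge0 x t0.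
have h3 : 0 <= (t - 2 * m - 2 * b) * (t - 2 * m - 2 * b).
  by rewrite -expr2 sqr_ge0.
by move: h1 h2 h3; lra.
Qed.

Lemma smoothing_weight_punctured a b m : 0 <= a -> 0 <= b -> 0 <= m ->
  b <= m + 3 / 32 * (a + b + 2 * m) ->
  a + Num.sqrt (2 * (a * b) + 2 * m ^+ 2) + b <= Num.sqrt 2 * (a + b + 2 * m).
Proof.
move=> a0 b0 m0 bm.
set t := a + b + 2 * m.
have t0 : 0 <= t by rewrite !addr_ge0 ?mulr_ge0.
(* 41/29 is a convergent of sqrt 2 from below. Since a + b = t - 2 m, the inner root may be as large
   as (41/29 - 1) t + 2 m, whence the 12/29. *)
have s2 : 41 / 29 <= Num.sqrt 2 :> R.
  have c0 : 0 <= 41 / 29 :> R by lra.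
  by rewrite -ler_sqr ?nnegrE ?sqrtr_ge0 ?c0// sqr_sqrtr//; lra.
have tE : a + b + 2 * m = t by [].
have h1 : Num.sqrt (2 * (a * b) + 2 * m ^+ 2) <= 12 / 29 * t + 2 * m.
  have r0 : 0 <= 12 / 29 * t + 2 * m by move: t0 m0; lra.
  rewrite -[leRHS]ger0_norm// -sqrtr_sqr ler_sqrt ?sqr_ge0//.
  have -> : a = t - b - 2 * m by rewrite -tE; ring.
  exact: punctured_quadratic.
have h2 : 41 / 29 * t <= Num.sqrt 2 * t by exact: ler_wpM2r.
by clearbody t; move: h1 h2 tE; lra.
Qed.

End smoothing_arithmetic.

Lemma ler_expect_sqrt (R : rcfType) (I : finType) (p : I -> R)
    (F : {ffun I -> bool} -> R) (e : R) :
  (forall i, 0 <= p i <= 1) -> expect p (fun w => F w ^+ 2) <= e ->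
  expect p (fun w => `|F w|) <= Num.sqrt e.
Proof.
move=> p01 Fe.
rewrite -[leLHS]ger0_norm; last by apply: (expect_ge0 p01) => w; exact: normr_ge0.
rewrite -sqrtr_sqr ler_sqrt; last first.
  by apply: le_trans Fe; apply: (expect_ge0 p01) => w; exact: sqr_ge0.
by apply: le_trans Fe; exact: expect_norm_sqr.
Qed.

Section smoothing.
Context {R : rcfType} {I : finType} (p : I -> R).
Hypothesis p01 : forall i, 0 <= p i <= 1.

Local Notation v := (bernoulli_variance p).

Let p0 i : 0 <= p i. Proof. by have /andP[] := p01 i. Qed.
Let q0 i : 0 <= 1 - p i.
Proof. by have /andP[] := p01 i; rewrite subr_ge0. Qed.
Let v0 i : 0 <= v i. Proof. exact: mulr_ge0. Qed.

Let ustat (A : {set I}) (c : I -> I -> R) w := \sum_(i in A) \sum_(j in A | j != i)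
  c i j * (centered p i w * centered p j w).

(** The diagonal terms are added back: this only increases the bound, and it makes the double sums
    factor. *)
Let ustat_norm (A : {set I}) c e : (forall i j, c i j = c j i) ->
  2 * (\sum_(i in A) \sum_(j in A) c i j ^+ 2 * (v i * v j)) = e ->
  expect p (fun w => `|ustat A c w|) <= Num.sqrt e.
Proof.
move=> csym <-; apply: ler_expect_sqrt => //.
rewrite expect_ustat_sqr// ler_wpM2l//; apply: ler_sum => i _.
rewrite [leRHS](bigID (fun j => j != i))/= lerDl.
by apply: sumr_ge0 => j _; rewrite mulr_ge0 ?sqr_ge0// mulr_ge0.
Qed.

Let sum_pairs (A : {set I}) (f g : I -> R) :
  \sum_(i in A) \sum_(j in A) f i * g j = (\sum_(i in A) f i) * \sum_(j in A) g j.
Proof. by rewrite mulr_suml; apply: eq_bigr => i _; rewrite mulr_sumr. Qed.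

(** The left factor is the sum of v_i v_j over i <> j. The weights [c0], [c1], [c2] of u(W), u(W+1),
    u(W+2) give U-statistics whose squared norms are at most 2 a^2, 2 (2 a b + 2 m^2) and 2 b^2. *)
Lemma second_difference_bound (A : {set I}) (u : nat -> R) C :
  (forall k, `|u k| <= C) ->
  ((\sum_(i in A) v i) ^+ 2 - \sum_(i in A) v i ^+ 2) *
  `|expect p (fun w => u (cnt A w).+2 - 2 * u (cnt A w).+1 + u (cnt A w))| <=
  C * (Num.sqrt 2 *
   (\sum_(i in A) v i * (1 - p i) ^+ 2
    + Num.sqrt (2 * ((\sum_(i in A) v i * (1 - p i) ^+ 2) *
                     (\sum_(i in A) v i * p i ^+ 2))
              + 2 * (\sum_(i in A) v i ^+ 2) ^+ 2)
    + \sum_(i in A) v i * p i ^+ 2)).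
Proof.
move=> uC.
set D := _ - _; set E := expect p _; set a := \sum_(i in A) v i * (1 - p i) ^+ 2.
set b := \sum_(i in A) v i * p i ^+ 2; set m := \sum_(i in A) v i ^+ 2.
have C0 : 0 <= C by apply: le_trans (uC 0%N).
have DE : D = \sum_(i in A) \sum_(j in A | j != i) v i * v j.
  rewrite /D expr2 -sum_pairs -sumrB; apply: eq_bigr => i Ai.
  by rewrite (bigD1 i)//= -expr2 addrAC subrr add0r.
have D0 : 0 <= D.
  by rewrite DE; do 2![apply: sumr_ge0 => ? _]; rewrite mulr_ge0.
have a0 : 0 <= a by apply: sumr_ge0 => i _; rewrite mulr_ge0// sqr_ge0.
have b0 : 0 <= b by apply: sumr_ge0 => i _; rewrite mulr_ge0// sqr_ge0.
rewrite -(ger0_norm D0) -normrM DE mulr_suml.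
pose c0 i j := (1 - p i) * (1 - p j).
pose c1 i j := (1 - p i) * p j + p i * (1 - p j).
pose c2 i j := p i * p j.
have -> : \sum_(i in A) (\sum_(j in A | j != i) v i * v j) * E =
    expect p (fun w => ustat A c0 w * u (cnt A w) + ustat A c1 w * u (cnt A w).+1
                       + ustat A c2 w * u (cnt A w).+2).
  transitivity (\sum_(i in A) \sum_(j in A | j != i)
    expect p (fun w => centered p i w * centered p j w *
    ((1 - p i) * (1 - p j) * u (cnt A w) +
     ((1 - p i) * p j + p i * (1 - p j)) * u (cnt A w).+1 +
     p i * p j * u (cnt A w).+2))).
    apply: eq_bigr => i Ai; rewrite mulr_suml; apply: eq_bigr => j /andP[Aj ji].
    by rewrite second_difference_expect// eq_sym.
  under eq_bigr do rewrite -expect_sum.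
  rewrite -expect_sum; apply: eq_expect => w.
  rewrite /ustat !mulr_suml -!big_split /=; apply: eq_bigr => i _.
  rewrite !mulr_suml -!big_split /=; apply: eq_bigr => j _.
  by rewrite /c0 /c1 /c2; ring.
apply: le_trans (ler_norm_expect p01 _) _.
apply: (@le_trans _ _ (expect p (fun w =>
   C * (`|ustat A c0 w| + `|ustat A c1 w| + `|ustat A c2 w|)))).
  apply: (ler_expect p01) => w.
  apply: le_trans (ler_normD _ _) _; rewrite !mulrDr; apply: lerD.
    apply: le_trans (ler_normD _ _) _; apply: lerD;
    by rewrite normrM mulrC ler_wpM2r.
  by rewrite normrM mulrC ler_wpM2r.
rewrite expectZ ler_wpM2l// !expectD !mulrDr; apply: lerD; first apply: lerD.
- rewrite -[a in leRHS]ger0_norm// -sqrtr_sqr -sqrtrM//.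
  apply: ustat_norm => [i j|]; first exact: mulrC.
  rewrite [a ^+ 2]expr2 -sum_pairs; congr (_ * _); apply: eq_bigr => i _.
  by apply: eq_bigr => j _; rewrite /c0; ring.
- rewrite -sqrtrM//.
  apply: ustat_norm => [i j|]; first by rewrite /c1; ring.
  rewrite [m ^+ 2]expr2 -!sum_pairs; congr (_ * _).
  transitivity (\sum_(i in A) \sum_(j in A) v i * (1 - p i) ^+ 2 * (v j * p j ^+ 2) +
     \sum_(i in A) \sum_(j in A) v i * p i ^+ 2 * (v j * (1 - p j) ^+ 2)
     + 2 * \sum_(i in A) \sum_(j in A) v i ^+ 2 * v j ^+ 2).
    rewrite -big_split mulr_sumr -big_split /=; apply: eq_bigr => i _.
    rewrite -big_split mulr_sumr -big_split /=; apply: eq_bigr => j _.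
    by rewrite /c1 /bernoulli_variance; ring.
  by rewrite !sum_pairs; ring.
- rewrite -[b in leRHS]ger0_norm// -sqrtr_sqr -sqrtrM//.
  apply: ustat_norm => [i j|]; first exact: mulrC.
  rewrite [b ^+ 2]expr2 -sum_pairs; congr (_ * _); apply: eq_bigr => i _.
  by apply: eq_bigr => j _; rewrite /c2; ring.
Qed.

End smoothing.

(** * Inequalities between power sums *)

Section power_sum_inequalities.
Context {R : realFieldType} {I : finType} (p : I -> R).
Hypothesis p01 : forall i, 0 <= p i <= 1.

Local Notation S := (moment_sum p).

Lemma sum_expr_ge0 k : 0 <= S k.
Proof. by apply: sumr_ge0 => i _; rewrite exprn_ge0//; have /andP[] := p01 i. Qed.

Lemma sum_expr_decreasing k : S k.+1 <= S k.
Proof.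
apply: ler_sum => i _; have /andP[p0 p1] := p01 i.
by rewrite exprS ler_piMl// exprn_ge0.
Qed.

(** Cauchy-Schwarz: multiplied by [S k], the gap is a sum of squares, an unnormalised variance of
    p_i under the weights p_i^k. *)
Lemma sum_expr_log_convex k : 0 < S k -> S k.+1 ^+ 2 <= S k * S k.+2.
Proof.
move=> Sk; rewrite -subr_ge0 -(pmulr_rge0 _ Sk).
suff -> : S k * (S k * S k.+2 - S k.+1 ^+ 2) =
    \sum_i p i ^+ k * (S k * p i - S k.+1) ^+ 2.
  apply: sumr_ge0 => i _; rewrite mulr_ge0 ?sqr_ge0// exprn_ge0//.
  by have /andP[] := p01 i.
rewrite (eq_bigr (fun i => S k ^+ 2 * p i ^+ k.+2 -
  2 * S k * S k.+1 * p i ^+ k.+1 + S k.+1 ^+ 2 * p i ^+ k)) => [|i _].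
  by rewrite big_split/= sumrB -!mulr_sumr -/(S _) -/(S _) -/(S _); ring.
by rewrite !exprS; ring.
Qed.

End power_sum_inequalities.

(** * Smoothing bounds for W and for W with one summand removed *)

Section poisson_binomial_smoothing.
Context {R : rcfType} {I : finType} (p : I -> R).
Hypothesis p01 : forall i, 0 <= p i <= 1.

Local Notation v := (bernoulli_variance p).
Local Notation S := (moment_sum p).

Variables (tau : R).
Hypothesis v_tau : forall i, v i <= tau.
Hypothesis tau_lt : 3 * tau < \sum_i v i.

Let p0 i : 0 <= p i. Proof. by have /andP[] := p01 i. Qed.
Let q0 i : 0 <= 1 - p i.
Proof. by have /andP[] := p01 i; rewrite subr_ge0. Qed.
Let v0 i : 0 <= v i. Proof. exact: mulr_ge0. Qed.

Hypothesis S2_gt0 : 0 < S 2.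
Hypothesis ratio_lt : 2 * S 3 < S 2.

Let a (A : {set I}) := \sum_(i in A) v i * (1 - p i) ^+ 2.
Let b (A : {set I}) := \sum_(i in A) v i * p i ^+ 2.
Let m (A : {set I}) := \sum_(i in A) v i ^+ 2.
Let s (A : {set I}) := \sum_(i in A) v i.

Let a0 A : 0 <= a A.
Proof. by apply: sumr_ge0 => i _; rewrite mulr_ge0// sqr_ge0. Qed.
Let b0 A : 0 <= b A.
Proof. by apply: sumr_ge0 => i _; rewrite mulr_ge0// sqr_ge0. Qed.
Let m0 A : 0 <= m A.
Proof. by apply: sumr_ge0 => i _; rewrite sqr_ge0. Qed.

Let sE A : a A + b A + 2 * m A = s A.
Proof.
rewrite mulr_sumr -!big_split; apply: eq_bigr => i _ /=.
by rewrite /bernoulli_variance; ring.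
Qed.

Let m_le A : m A <= tau * s A.
Proof.
by rewrite mulr_sumr; apply: ler_sum => i _; rewrite expr2 ler_wpM2r.
Qed.

Let bT : b [set: I] = S 3 - S 4.
Proof.
rewrite /b /moment_sum -sumrB; apply: eq_big => [i|i _]; first by rewrite inE.
by rewrite /bernoulli_variance; ring.
Qed.

Let mT : m [set: I] = S 2 - 2 * S 3 + S 4.
Proof.
rewrite /m /moment_sum mulr_sumr -sumrB -big_split.
apply: eq_big => [i|i _]; first by rewrite inE.
by rewrite /bernoulli_variance /=; ring.
Qed.

Let sT : s [set: I] = \sum_i v i.
Proof. by apply: eq_bigl => i; rewrite inE. Qed.

Let S3_sqr : S 3 ^+ 2 <= S 2 * S 4.
Proof. exact: sum_expr_log_convex. Qed.

Let S3_le : S 3 <= S 2. Proof. exact: sum_expr_decreasing. Qed.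

Let S30 : 0 <= S 3. Proof. exact: sum_expr_ge0. Qed.

(* This is where p < 1/2 enters. *)
Let b_le_m : b [set: I] <= m [set: I].
Proof.
rewrite bT mT -(ler_pM2l S2_gt0).
(* The gap to be shown nonnegative is S 2 - 3 S 3 + 2 S 4. Times [S 2], and with S 2 S 4 bounded
   below by the square of S 3, it is at least this product. *)
have : 0 <= (S 2 - S 3) * (S 2 - 2 * S 3).
  by rewrite mulr_ge0// subr_ge0// ltW.
by move: S3_sqr; nra.
Qed.

(** Since [m A <= tau * s A], the sum of v_i v_j over i <> j in A is at least
    [s A * (s A - tau)]. *)
Let bound (A : {set I}) u C : (forall k, `|u k| <= C) ->
  s A * (s A - tau) *
  `|expect p (fun w => u (cnt A w).+2 - 2 * u (cnt A w).+1 + u (cnt A w))| <=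
  C * (Num.sqrt 2 * (a A + Num.sqrt (2 * (a A * b A) + 2 * m A ^+ 2) + b A)).
Proof.
move=> uC; apply: le_trans (second_difference_bound p01 A uC).
rewrite ler_wpM2r// mulrBr -expr2 lerB//.
by apply: le_trans (m_le A) _; rewrite mulrC.
Qed.

(** [tau] is only known to dominate every [v i], so its sign requires an index to exist; [S2_gt0]
    excludes an empty [I]. *)
Lemma variance_bound_ge0 : 0 <= tau.
Proof.
have [noI|] := posnP #|I|; last first.
  by move=> /card_gt0P[i _]; exact: le_trans (v0 i) (v_tau i).
by move: S2_gt0; rewrite /moment_sum big1 ?ltxx// => i; have /(_ noI) := fintype0 i.
Qed.

Let tau0 := variance_bound_ge0.

Lemma second_difference_full (u : nat -> R) C : (forall k, `|u k| <= C) ->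
  (1 - 2 * (S 3 / S 2)) *
  `|expect p (fun w => u (cnt [set: I] w).+2 - 2 * u (cnt [set: I] w).+1
                       + u (cnt [set: I] w))|
  <= C * (2 / (Num.sqrt (\sum_i v i) * Num.sqrt (\sum_i v i - tau))).
Proof.
move=> uC; rewrite -sT.
set e := 1 - _; set N := `| _ |.
have t3 : 3 * tau < s [set: I] by rewrite sT.
have C0 : 0 <= C by apply: le_trans (uC 0%N).
have e0 : 0 < e by rewrite subr_gt0 mulrA ltr_pdivrMr// mul1r.
have e1 : e <= 1 by rewrite gerBl mulr_ge0// divr_ge0// ltW.
(* As b + m = S 2 - S 3, this reduces to 2 (S 3)^2 <= S 2 S 3 + S 2 S 4, a sum of two known
   inequalities. *)
have ebm : e * (b [set: I] + m [set: I]) <= m [set: I].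
  rewrite bT mT -(ler_pM2l S2_gt0) mulrA.
  have -> : S 2 * e = S 2 - 2 * S 3 by rewrite /e; field; exact: lt0r_neq0.
  have : S 3 * S 3 <= S 2 * S 3 by exact: ler_wpM2r.
  by move: S3_sqr; nra.
have s0 : 0 < s [set: I] by move: t3 tau0; lra.
have st0 : 0 < s [set: I] - tau by move: t3 tau0; lra.
have h1 : s [set: I] * (s [set: I] - tau) * (e * N) <= C * (Num.sqrt 2 * s [set: I]).
  apply: (@le_trans _ _ (e * (C * (Num.sqrt 2 *
      (a [set: I] + Num.sqrt (2 * (a [set: I] * b [set: I])
                              + 2 * m [set: I] ^+ 2) + b [set: I]))))).
    by rewrite mulrCA ler_wpM2l ?(ltW e0)//; exact: bound.
  rewrite mulrCA ler_wpM2l// mulrCA ler_wpM2l ?sqrtr_ge0//.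
  by rewrite -sE; exact: smoothing_weight_full.
have h2 : (s [set: I] - tau) * (e * N) <= C * Num.sqrt 2.
  rewrite -(ler_pM2l s0) mulrA; apply: le_trans h1 _.
  by rewrite mulrA [leRHS]mulrC.
rewrite mulrA ler_pdivlMr ?mulr_gt0 ?sqrtr_gt0//.
(* From s > 3 tau follows s <= 2 (s - tau), which turns sqrt 2 / (s - tau) into the symmetric bound
   2 / (sqrt s sqrt (s - tau)). *)
have h3 : Num.sqrt (s [set: I]) <= Num.sqrt 2 * Num.sqrt (s [set: I] - tau).
  by rewrite -sqrtrM// ler_sqrt ?mulr_ge0 ?(ltW st0)//; move: t3 tau0; lra.
have N0 : 0 <= e * N by apply: mulr_ge0; [exact: ltW|exact: normr_ge0].
apply: (@le_trans _ _ (e * N * (Num.sqrt 2 * (s [set: I] - tau)))).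
  rewrite ler_wpM2l// -[X in _ <= _ * X](sqr_sqrtr (ltW st0)) expr2 mulrA.
  by rewrite ler_wpM2r ?sqrtr_ge0.
rewrite mulrCA [_ * (s [set: I] - tau)]mulrC.
apply: le_trans (ler_wpM2l (sqrtr_ge0 _) h2) _.
by rewrite mulrCA -expr2 sqr_sqrtr.
Qed.

Lemma second_difference_punctured i (u : nat -> R) C : (forall k, `|u k| <= C) ->
  `|expect p (fun w => u (cnt (~: [set i]) w).+2 - 2 * u (cnt (~: [set i]) w).+1
                       + u (cnt (~: [set i]) w))|
  <= C * (2 / Num.sqrt ((\sum_i v i - tau) * (\sum_i v i - 3 * tau))).
Proof.
move=> uC; set A := ~: [set i]; set N := `| _ |; set sg := \sum_i v i.
have C0 : 0 <= C by apply: le_trans (uC 0%N).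
have AE (f : I -> R) : \sum_(j in A) f j = \sum_(j in [set: I]) f j - f i.
  rewrite [in RHS](bigD1 i) ?inE//= addrAC subrr add0r.
  by apply: eq_bigl => j; rewrite !inE.
have sA : s A = sg - v i by rewrite /s AE -/(s _) sT.
have viq : v i <= 1 / 4.
  by have := sqr_ge0 (2 * p i - 1); rewrite /bernoulli_variance; nra.
(* The comparison of b with m is available only on the full index set; putting i back costs v_i^2 on
   the side of m. *)
have bA : b A <= m A + v i ^+ 2.
  rewrite /m AE subrK; apply: le_trans b_le_m.
  by rewrite /b AE gerBl mulr_ge0// sqr_ge0.
have vi := v_tau i.
have t3 : 3 * tau < sg by [].
have h0 := bound A uC.
rewrite -/N in h0.
have N0 : 0 <= N by exact: normr_ge0.
have tp : 0 < s A by rewrite sA; move: tau0 vi t3; lra.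
have tq : 0 < sg - 2 * tau by move: tau0 t3; lra.
have tt : sg - 2 * tau <= s A - tau by rewrite sA; move: vi; lra.
(* [sqrt kappa] bounds the ratio of smoothing weight to variance. Then [s A] cancels, leaving N <= C
   sqrt (2 kappa) / (sg - 2 tau), and the last premise compares this with the claim. *)
have main kappa : 0 <= kappa ->
    a A + Num.sqrt (2 * (a A * b A) + 2 * m A ^+ 2) + b A <= Num.sqrt kappa * s A ->
    2 * kappa * ((sg - tau) * (sg - 3 * tau)) <= 4 * (sg - 2 * tau) ^+ 2 ->
    N <= C * (2 / Num.sqrt ((sg - tau) * (sg - 3 * tau))).
  move=> k0 hk hs.
  have X0 : 0 < (sg - tau) * (sg - 3 * tau).
    by rewrite mulr_gt0//; move: tau0 t3; lra.
  rewrite mulrA ler_pdivlMr ?sqrtr_gt0//.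
  have h1 : (sg - 2 * tau) * N <= C * Num.sqrt (2 * kappa).
    rewrite -(ler_pM2l tp).
    apply: (@le_trans _ _ (s A * (s A - tau) * N)).
      by rewrite -mulrA ler_wpM2l ?(ltW tp)// ler_wpM2r.
    apply: le_trans h0 _; rewrite sqrtrM//.
    rewrite (_ : s A * _ = C * (Num.sqrt 2 * (Num.sqrt kappa * s A))); last by ring.
    by rewrite !ler_wpM2l ?sqrtr_ge0.
  rewrite -(ler_pM2l tq) mulrA.
  apply: le_trans (ler_wpM2r (sqrtr_ge0 _) h1) _.
  rewrite -mulrA [leRHS]mulrCA ler_wpM2l//.
  rewrite -sqrtrM ?mulr_ge0//.
  rewrite -[leRHS]ger0_norm; last by rewrite mulr_ge0// ltW.
  rewrite -sqrtr_sqr ler_sqrt ?sqr_ge0//.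
  by rewrite (_ : (_ * 2) ^+ 2 = 4 * (sg - 2 * tau) ^+ 2); [exact: hs|ring].
(* For large tau the crude bound wins, thanks to the gap between sg - 2 tau and
   the geometric mean of sg - tau and sg - 3 tau.  Otherwise v_i^2 <= v_i / 4 is at
   most 3 / 32 of the remaining variance sg - v_i. *)
have [big|small] := leP (3 / 11 * sg) tau.
  apply: (main 3) => //; first by rewrite -sE smoothing_weight_crude.
  exact: punctured_large_tau.
apply: (main 2) => //; last first.
  by rewrite [_ ^+ 2]expr2; have := mulr_ge0 tau0 tau0; lra.
rewrite -sE; apply: smoothing_weight_punctured => //.
apply: le_trans bA _; rewrite lerD2l sE.
have : v i * v i <= v i * (1 / 4) by exact: ler_wpM2l.
rewrite expr2 sA; move: small vi; lra.
Qed.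

End poisson_binomial_smoothing.

(** * The Poisson Stein equation *)

Section weighted_series.
Local Open Scope classical_set_scope.
Context {R : realType}.
Implicit Types (b u g : R^nat) (C : R).

Definition mean b u : R := limn (series (fun k => b k * u k)).

Lemma eq_limn_series u g : u =1 g -> limn (series u) = limn (series g).
Proof. by move=> /funext ->. Qed.

Lemma cvg_series_dominated b u C : (forall k, 0 <= b k) -> cvgn (series b) ->
  (forall k, `|u k| <= C) -> cvgn [normed series (fun k => b k * u k)].
Proof.
move=> b0 cb uC.
apply: (@series_le_cvg _ _ (C *: b)) => [k|k|k|].
- exact: normr_ge0.
- by rewrite /GRing.scale /= mulr_ge0// (le_trans _ (uC 0%N)).
- by rewrite /GRing.scale /= normrM ger0_norm// mulrC ler_wpM2r.
- exact: is_cvg_seriesZ.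
Qed.

Lemma is_cvg_mean b u C : (forall k, 0 <= b k) -> cvgn (series b) ->
  (forall k, `|u k| <= C) -> cvgn (series (fun k => b k * u k)).
Proof. by move=> b0 cb uC; apply/normed_cvg/(cvg_series_dominated b0 cb uC). Qed.

Lemma norm_limn_series_le u b C : cvgn (series b) ->
  (forall k, `|u k| <= C * b k) -> `|limn (series u)| <= C * limn (series b).
Proof.
move=> cb ub.
have cCb : cvgn (series (C *: b)) by exact: is_cvg_seriesZ.
have cu : cvgn [normed series u].
  apply: (@series_le_cvg _ _ (C *: b)) => [k|k|k|//]; first exact: normr_ge0.
    by apply: le_trans (ub k).
  exact: ub.
apply: le_trans (lim_series_norm cu) _.
rewrite -[leRHS](lim_seriesZ C cb); apply: lim_series_le => //.
Qed.

Lemma limn_series_shift u g : u 0%N = 0 -> (forall k, u k.+1 = g k) ->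
  cvgn (series g) ->
  cvgn (series u) /\ limn (series u) = limn (series g).
Proof.
move=> u0 ug cg.
have uE n : series u n.+1 = series g n.
  rewrite /series /= big_nat_recl// u0 add0r.
  by apply: eq_bigr => k _; rewrite ug.
suff cu : series u @ \oo --> limn (series g).
  by split; [exact: cvgP cu|exact: cvg_lim cu].
rewrite -cvg_shiftS; rewrite (_ : [sequence _]_n = series g)//.
exact: funext.
Qed.

Lemma limn_series_recl u : cvgn (series u) ->
  limn (series u) = u 0%N + limn (series (fun k => u k.+1)).
Proof.
move=> cu.
have uE n : series (fun k => u k.+1) n = series u n.+1 - u 0%N.
  by rewrite /series /= big_nat_recl// addrAC subrr add0r.
suff : series (fun k => u k.+1) @ \oo --> limn (series u) - u 0%N.
  by move=> /cvg_lim -> //; rewrite addrC subrK.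
rewrite (_ : series _ = (fun n => series u n.+1 - u 0%N)); last exact: funext.
by apply: cvgB; [rewrite cvg_shiftS|exact: cvg_cst].
Qed.

Lemma limn_series_finite u N : (forall k, (N <= k)%N -> u k = 0) ->
  cvgn (series u) /\ limn (series u) = \sum_(0 <= k < N) u k.
Proof.
move=> u0.
suff cu : series u @ \oo --> \sum_(0 <= k < N) u k.
  by split; [exact: cvgP cu|exact: cvg_lim cu].
rewrite -(cvg_shiftn N); rewrite (_ : [sequence _]_n = cst (\sum_(0 <= k < N) u k)).
  exact: cvg_cst.
apply/funext => n; rewrite /= /series /= (big_cat_nat (n := N))//= ?leq_addl//.
rewrite [X in _ + X]big1_seq ?addr0// => k.
by rewrite mem_index_iota => /andP[_ /andP[/u0]].
Qed.

End weighted_series.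

(** * Explicit solution of the Stein equation and its increments *)

Section poisson_stein.
Local Open Scope classical_set_scope.
Context {R : realType} (lam : R) (pi : R^nat) (f : R^nat).
Hypothesis lam0 : 0 < lam.
Hypothesis pi0 : forall k, 0 < pi k.
Hypothesis piS : forall k, k.+1%:R * pi k.+1 = lam * pi k.
Hypothesis pi_cvg : series pi @ \oo --> (1 : R).
Hypothesis f1 : forall k, `|f k| <= 1.

Let pi_ge0 k : 0 <= pi k. Proof. exact: ltW. Qed.
Let pi_cvgn : cvgn (series pi). Proof. exact: cvgP pi_cvg. Qed.

(** [series pi k.+1] sums the indices up to and including k, so [F] is the Poisson distribution
    function. *)
Let F k := series pi k.+1.
Let S k := series (fun j => pi j * f j) k.+1.
Let c := mean pi f.

Let FS k : F k.+1 = F k + pi k.+1.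
Proof. by rewrite /F seriesSr. Qed.

Let SS k : S k.+1 = S k + pi k.+1 * f k.+1.
Proof. by rewrite /S seriesSr. Qed.

Let F0 : F 0 = pi 0. Proof. by rewrite /F /series /= big_nat1. Qed.
Let S0 : S 0 = pi 0 * f 0. Proof. by rewrite /S /series /= big_nat1. Qed.

Let F_ge0 k : 0 <= F k.
Proof. by apply: sumr_ge0. Qed.

Let F_le1 k : F k <= 1.
Proof.
have := nondecreasing_cvgn_le (nondecreasing_series (fun n _ _ => pi_ge0 n)) pi_cvgn k.+1.
by rewrite (cvg_lim _ pi_cvg).
Qed.

Let S_le k : `|S k| <= F k.
Proof.
apply: le_trans (ler_norm_sum _ _ _) _; apply: ler_sum => j _.
by rewrite normrM ger0_norm// ler_piMr.
Qed.

Let tail_le k : `|c - S k| <= 1 - F k.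
Proof.
have cpf : cvgn (series (fun j => pi j * f j)) by exact: is_cvg_mean f1.
have cS : (fun n => `|series (fun j => pi j * f j) n - S k|) @ \oo --> `|c - S k|.
  by apply: cvg_norm; apply: cvgB; [exact: cpf|exact: cvg_cst].
have cF : (fun n => series pi n - F k) @ \oo --> 1 - F k.
  by apply: cvgB; [exact: pi_cvg|exact: cvg_cst].
apply: (ler_cvg_to cS cF); near=> n.
have kn : (k.+1 <= n)%N by near: n; exact: nbhs_infty_ge.
rewrite /S /F !sub_series_geq//; apply: le_trans (ler_norm_sum _ _ _) _.
by apply: ler_sum => j _; rewrite normrM ger0_norm// ler_piMr.
Unshelve. all: by end_near. Qed.

(** Here and in [tail_ineq], lam pi_j = (j + 1) pi_(j+1) allows a termwise comparison: j + 1 <= k +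
    1 up to k, and the reverse in the tail. *)
Let cdf_ineq k : lam * F k <= k.+1%:R * F k.+1.
Proof.
elim: k => [|k IH].
  by rewrite FS F0 mul1r -[lam * _]piS mul1r lerDr.
rewrite [F k.+2]FS [X in lam * X]FS mulrDr [k.+2%:R * _]mulrDr piS lerD2r.
by apply: le_trans IH _; rewrite ler_wpM2r// ler_nat.
Qed.

Let tail_ineq k : k.+1%:R * (1 - F k.+1) <= lam * (1 - F k).
Proof.
have cl : (fun n => k.+1%:R * (series pi n.+1 - F k.+1)) @ \oo -->
    k.+1%:R * (1 - F k.+1).
  apply: cvgMr; apply: cvgB; last exact: cvg_cst.
  by rewrite cvg_shiftS.
have cr : (fun n => lam * (series pi n - F k)) @ \oo --> lam * (1 - F k).
  apply: cvgMr; apply: cvgB; [exact: pi_cvg|exact: cvg_cst].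
apply: (ler_cvg_to cl cr); near=> n.
have kn : (k.+1 <= n)%N by near: n; exact: nbhs_infty_ge.
rewrite /F !sub_series_geq// !mulr_sumr big_add1 /=.
rewrite [leLHS]big_nat_cond [leRHS]big_nat_cond.
apply: ler_sum => j /andP[/andP[kj _] _].
by rewrite -piS ler_wpM2r// ler_nat ltnW.
Unshelve. all: by end_near. Qed.

(** By [tail_ineq] the tails satisfy as an inequality the recurrence that [pi] satisfies exactly.
    This serves to bound [G] and secure convergence; its constant does not reach the final
    estimate. *)
Let tail_pi k : 1 - F k <= pi k / pi 0.
Proof.
elim: k => [|k IH].
  by rewrite divff ?gt_eqF// gerBl.
rewrite -(ler_pM2l (ltr0Sn R k)) mulrA piS -mulrA.
by apply: le_trans (tail_ineq k) _; rewrite ler_pM2l.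
Qed.

(** Multiplied by [pi k], the left side of the Stein equation telescopes, so lam pi_k G(k) must be
    the partial sum of pi (f - c). *)
Let G k := (S k - c * F k) / (lam * pi k).

Lemma poisson_stein_solution : exists (c : R) (G : R^nat) (B : R),
  [/\ forall k, lam * G k - k%:R * G k.-1 = f k - c,
      forall k, `|G k| <= B & forall k, `|G k.+1 - G k| <= 2 / lam].
Proof.
exists c, G, (2 / (lam * pi 0)).
have lampi k : lam * pi k != 0 by rewrite mulf_neq0 ?gt_eqF.
split=> [[|k]|k|k].
- rewrite mul0r subr0 /G F0 S0.
  by field; rewrite !gt_eqF.
- rewrite /G /= SS FS -[lam * pi k]piS.
  by field; rewrite !gt_eqF ?ltr0Sn//.
- rewrite /G normrM normfV [`|lam * _|]gtr0_norm ?mulr_gt0//.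
  rewrite ler_pdivrMr ?mulr_gt0//.
  rewrite (_ : 2 / _ * _ = 2 * (pi k / pi 0)); last by field; rewrite !gt_eqF.
  (* In this form both terms are at most the tail 1 - F k, hence comparable to the denominator for
     large k. *)
  have -> : S k - c * F k = (1 - F k) * S k - F k * (c - S k) by ring.
  apply: le_trans (ler_normB _ _) _; rewrite !normrM.
  rewrite (ger0_norm (F_ge0 k)) ger0_norm ?subr_ge0//.
  have h1 : (1 - F k) * `|S k| <= (1 - F k) * 1.
    by rewrite ler_wpM2l ?subr_ge0//; exact: le_trans (S_le k) (F_le1 k).
  have h2 : F k * `|c - S k| <= 1 * (1 - F k).
    by rewrite ler_pM// tail_le.
  by have := tail_pi k; lra.
- rewrite /G SS FS -[lam * pi k]piS.
  set T := c - S k.+1; set K : R := k.+1%:R.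
  have K0 : 0 < K by rewrite ltr0Sn.
  (* As a linear functional of f the increment has one sign on f(k+1) and the
     other on both tails. *)
  have -> : (S k + pi k.+1 * f k.+1 - c * (F k + pi k.+1)) / (lam * pi k.+1) -
     (S k - c * F k) / (K * pi k.+1) =
     (S k * (K * (1 - F k.+1) - lam * (1 - F k)) +
      f k.+1 * (pi k.+1 * (K * (1 - F k.+1) + lam * F k)) +
      T * (lam * F k - K * F k.+1)) / (lam * K * pi k.+1).
    by rewrite /T SS FS; field; rewrite !gt_eqF.
  have d0 : 0 < lam * K * pi k.+1 by rewrite !mulr_gt0.
  rewrite normrM normfV (gtr0_norm d0) ler_pdivrMr//.
  have -> : 2 / lam * (lam * K * pi k.+1) = 2 * K * pi k.+1.
    by field; rewrite gt_eqF.
  have x1 : 0 <= lam * (1 - F k) - K * (1 - F k.+1) by rewrite subr_ge0 tail_ineq.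
  have x2 : 0 <= pi k.+1 * (K * (1 - F k.+1) + lam * F k).
    by rewrite mulr_ge0// addr_ge0// mulr_ge0 ?subr_ge0// ltW.
  have x3 : 0 <= K * F k.+1 - lam * F k by rewrite subr_ge0 cdf_ineq.
  have y1 : `|S k * (K * (1 - F k.+1) - lam * (1 - F k))| <=
      F k * (lam * (1 - F k) - K * (1 - F k.+1)).
    by rewrite normrM distrC (ger0_norm x1) ler_wpM2r.
  have y2 : `|f k.+1 * (pi k.+1 * (K * (1 - F k.+1) + lam * F k))| <=
      pi k.+1 * (K * (1 - F k.+1) + lam * F k).
    by rewrite normrM (ger0_norm x2) ler_piMl.
  have y3 : `|T * (lam * F k - K * F k.+1)| <=
      (1 - F k.+1) * (K * F k.+1 - lam * F k).
    by rewrite normrM [X in _ * X]distrC (ger0_norm x3) ler_wpM2r// tail_le.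
  apply: le_trans (ler_normD _ _) _.
  apply: le_trans (lerD (le_trans (ler_normD _ _) (lerD y1 y2)) y3) _.
  (* The three bounds add up to 2 pi_(k+1) (lam F_k + K (1 - F_(k+1))), and lam F_k <= K F_(k+1)
     brings this down to 2 K pi_(k+1). *)
  have z : 0 <= pi k.+1 * (K * F k.+1 - lam * F k) by exact: mulr_ge0.
  by move: z; rewrite FS; nra.
Qed.

End poisson_stein.

(** * The BCP law as a perturbed Poisson law *)

Section geometric_inverse.
Local Open Scope classical_set_scope.
Context {R : realType}.

(* H is the Neumann series of (1 + p Delta)^-1 applied to G; it converges since
   p / (1 - p) < 1. *)
Lemma bounded_resolvent (p : R) (G : R^nat) (B L : R) :
  0 <= p -> p < 1 / 2 ->
  (forall k, `|G k| <= B) -> (forall k, `|G k.+1 - G k| <= L) ->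
  exists (H : R^nat) (B' : R), [/\ forall k, (1 - p) * H k + p * H k.+1 = G k,
    forall k, `|H k| <= B' & forall k, `|H k.+1 - H k| <= L / (1 - 2 * p)].
Proof.
move=> p0 p2 GB GL.
have q0 : 0 < 1 - p by lra.
(* The weights p^j / (1 - p)^(j+1), with alternating signs, form the Neumann series; their absolute
   sum is 1 / (1 - 2 p). *)
pose b : R^nat := geometric (1 - p)^-1 (p / (1 - p)).
have z0 : 0 <= p / (1 - p) by rewrite divr_ge0// ltW.
have z1 : `|p / (1 - p)| < 1 by rewrite ger0_norm// ltr_pdivrMr//; lra.
have b0 k : 0 <= b k by rewrite mulr_ge0 ?exprn_ge0// invr_ge0 ltW.
have cb := @cvg_geometric_series R (1 - p)^-1 _ z1.
have cbn : cvgn (series b) by exact: cvgP cb.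
have limb : limn (series b) = (1 - 2 * p)^-1.
  rewrite (cvg_lim _ cb)//; field.
  by rewrite !gt_eqF//; lra.
pose h k j := b j * ((-1) ^+ j * G (k + j)%N).
have ch k : cvgn (series (h k)).
  by apply: (is_cvg_mean (C := B)) => // j; rewrite normrM normrX normrN1 expr1n mul1r.
exists (fun k => limn (series (h k))), (B * (1 - 2 * p)^-1); split=> k.
- rewrite (limn_series_recl (ch k)).
  have -> : (fun j => h k j.+1) = (- (p / (1 - p))) *: h k.+1.
    apply/funext => j; rewrite /GRing.scale /= /h /b /= addnS addSn !exprS.
    by rewrite /GRing.scale /=; ring.
  rewrite (lim_seriesZ _ (ch _)) /h /b /= /GRing.scale /= addn0 !expr0.
  by field; rewrite gt_eqF.
- rewrite -limb; apply: norm_limn_series_le => // j.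
  by rewrite normrM normrMsign ger0_norm// mulrC ler_wpM2r.
- rewrite -lim_seriesB// -limb; apply: norm_limn_series_le => // j.
  rewrite (_ : (h k.+1 - h k) j = b j * ((-1) ^+ j * (G (k + j).+1 - G (k + j)%N))).
    by rewrite normrM normrMsign ger0_norm// mulrC ler_wpM2r.
  by rewrite /h !mulrBr.
Qed.

End geometric_inverse.

Section bcp_mass_function.
Local Open Scope classical_set_scope.
Context {R : realType}.
Implicit Types (al p : R).

Definition poisson_mass al : R^nat := fun k => expR (- al) * exp_coeff al k.

(** One Bernoulli summand is convolved at a time, which suits induction on M; [bcp_mass_convolution]
    relates this to the Poisson-binomial convolution. *)
Fixpoint bcp_mass al p M : R^nat :=
  if M is M'.+1 then fun k => (1 - p) * bcp_mass al p M' k +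
    p * (if k is k'.+1 then bcp_mass al p M' k' else 0)
  else poisson_mass al.

Lemma poisson_mass_recl al k :
  k.+1%:R * poisson_mass al k.+1 = al * poisson_mass al k.
Proof.
rewrite /poisson_mass /exp_coeff /= factS natrM exprS.
by field; rewrite nat1r !pnatr_eq0 -lt0n fact_gt0.
Qed.

Lemma poisson_mass_gt0 al k : 0 < al -> 0 < poisson_mass al k.
Proof.
move=> al0; rewrite /poisson_mass /exp_coeff /= mulr_gt0 ?expR_gt0//.
by rewrite divr_gt0 ?exprn_gt0// ltr0n fact_gt0.
Qed.

Lemma poisson_mass_cvg al : series (poisson_mass al) @ \oo --> (1 : R).
Proof.
rewrite (_ : series _ = (fun n => expR (- al) * series (exp_coeff al) n)); last first.
  by apply/funext => n; rewrite /series /= mulr_sumr.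
rewrite (_ : 1 = expR (- al) * expR al); last first.
  by rewrite -expRD addNr expR0.
by apply: cvgMr; exact: is_cvg_series_exp_coeff.
Qed.

Section fixed_parameters.
Variables (al p : R).
Hypotheses (al0 : 0 <= al) (p0 : 0 <= p) (p1 : p <= 1).

Lemma bcp_mass_ge0 M k : 0 <= bcp_mass al p M k.
Proof.
have q0 : 0 <= 1 - p by rewrite subr_ge0.
elim: M k => [|M IH] k /=.
  by rewrite /poisson_mass mulr_ge0 ?expR_ge0 ?exp_coeff_ge0.
by rewrite addr_ge0 ?mulr_ge0//; case: k.
Qed.

(** Conditioning on the last Bernoulli summand: u(Y + I) averages to (1 - p) u(Y) + p u(Y + 1). The
    conclusion includes convergence. *)
Lemma bcp_mass_mean M (u : R^nat) C : cvgn (series (bcp_mass al p M)) ->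
  (forall k, `|u k| <= C) ->
  let v := fun k => bcp_mass al p M k * ((1 - p) * u k + p * u k.+1) in
  let w := fun k => bcp_mass al p M.+1 k * u k in
  series w @ \oo --> limn (series v).
Proof.
move=> cb uC v w.
have b0 := bcp_mass_ge0 M.
pose w1 k := bcp_mass al p M k * u k.
pose w2 k := if k is k'.+1 then bcp_mass al p M k' * u k'.+1 else 0.
pose w3 k := bcp_mass al p M k * u k.+1.
have c1 : cvgn (series w1) by exact: (is_cvg_mean (C := C)).
have c3 : cvgn (series w3) by exact: (is_cvg_mean (C := C)).
have [c2 l2] := limn_series_shift (u := w2) (g := w3) erefl (fun=> erefl) c3.
have -> : v = (1 - p) *: w1 + p *: w3.
  apply/funext => k; rewrite /v /w1 /w3.
  rewrite (_ : (_ + _) k = (1 - p) * w1 k + p * w3 k)// /w1 /w3; ring.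
have -> : w = (1 - p) *: w1 + p *: w2.
  apply/funext => k; rewrite /w /w1 /w2.
  rewrite (_ : (_ + _) k = (1 - p) * w1 k + p * w2 k)// /w1 /w2.
  by case: k => [|k] /=; ring.
have e : limn (series ((1 - p) *: w1 + p *: w2)) =
    limn (series ((1 - p) *: w1 + p *: w3)).
  rewrite (lim_seriesD (is_cvg_seriesZ c1) (is_cvg_seriesZ c2)).
  rewrite (lim_seriesD (is_cvg_seriesZ c1) (is_cvg_seriesZ c3)).
  by rewrite (lim_seriesZ _ c1) (lim_seriesZ _ c2) (lim_seriesZ _ c3) l2.
by rewrite -e; apply: is_cvg_seriesD; exact: is_cvg_seriesZ.
Qed.

Lemma bcp_mass_cvg M : series (bcp_mass al p M) @ \oo --> (1 : R).
Proof.
elim: M => [|M IH]; first exact: poisson_mass_cvg.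
have := @bcp_mass_mean M (cst 1) 1 (cvgP _ IH); cbv zeta.
rewrite (_ : (fun k => bcp_mass al p M k * _) = bcp_mass al p M); last first.
  by apply/funext => k; rewrite !mulr1 subrK mulr1.
rewrite (_ : (fun k => bcp_mass al p M.+1 k * _) = bcp_mass al p M.+1); last first.
  by apply/funext => k; rewrite mulr1.
by rewrite (cvg_lim _ IH)//; apply => k; rewrite normr1.
Qed.

(** Coefficientwise, this is the derivative of the generating function (q + p z)^M exp(al (z - 1)).
    At M = 0 the predecessor is multiplied by zero. *)
Lemma bcp_mass_recl M k : k.+1%:R * bcp_mass al p M k.+1 =
  al * bcp_mass al p M k + M%:R * p * bcp_mass al p M.-1 k.
Proof.
elim: M k => [|M IH] k.
  by rewrite mul0r mul0r addr0; exact: poisson_mass_recl.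
have -> : k.+1%:R * bcp_mass al p M.+1 k.+1 =
    (1 - p) * (k.+1%:R * bcp_mass al p M k.+1) +
    p * (k%:R * bcp_mass al p M k) + p * bcp_mass al p M k.
  by rewrite /= -[k.+1]addn1 natrD; ring.
rewrite IH; case: M IH => [|M] IH; case: k => [|k].
- by rewrite /=; ring.
- by rewrite [k.+1%:R * bcp_mass al p 0 k.+1]IH /=; ring.
- by rewrite -[M.+2%:R]natr1 /=; ring.
- rewrite [k.+1%:R * bcp_mass al p M.+1 k.+1]IH -[M.+2%:R]natr1 /=; ring.
Qed.

(** The recurrence produces E G(Y') with one Bernoulli summand fewer. By the choice of [H], E G(Y')
    = E H(Y), so the law of Y' is eliminated. *)
Lemma bcp_stein M (G H : R^nat) B B' :
  (forall k, `|G k| <= B) -> (forall k, `|H k| <= B') ->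
  (forall k, (1 - p) * H k + p * H k.+1 = G k) ->
  series (fun k => bcp_mass al p M k * (k%:R * G k.-1)) @ \oo -->
  al * mean (bcp_mass al p M) G + M%:R * p * mean (bcp_mass al p M) H.
Proof.
move=> GB HB HG.
have cG N : cvgn (series (fun k => bcp_mass al p N k * G k)).
  by apply: is_cvg_mean GB; [exact: bcp_mass_ge0|exact: cvgP (bcp_mass_cvg N)].
have -> : M%:R * p * mean (bcp_mass al p M) H =
    M%:R * p * mean (bcp_mass al p M.-1) G.
  case: M => [|M]; first by rewrite !mul0r.
  congr (_ * _); rewrite /mean.
  have := bcp_mass_mean (cvgP _ (bcp_mass_cvg M)) HB.
  move=> /cvg_lim -> //; apply: eq_limn_series => k.
  by rewrite HG.
pose g := al *: (fun k => bcp_mass al p M k * G k) +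
  (M%:R * p) *: (fun k => bcp_mass al p M.-1 k * G k).
have cg : cvgn (series g) by apply: is_cvg_seriesD; exact: is_cvg_seriesZ.
have [||cu lu] := @limn_series_shift R
  (fun k => bcp_mass al p M k * (k%:R * G k.-1)) g _ _ cg.
- by rewrite mul0r mulr0.
- move=> k; rewrite /= mulrA [_ * k.+1%:R]mulrC bcp_mass_recl.
  rewrite (_ : g k = al * (bcp_mass al p M k * G k) +
    (M%:R * p) * (bcp_mass al p M.-1 k * G k))//; ring.
suff <- : limn (series g) = al * mean (bcp_mass al p M) G +
  M%:R * p * mean (bcp_mass al p M.-1) G by rewrite -lu.
rewrite (lim_seriesD (is_cvg_seriesZ (cG M)) (is_cvg_seriesZ (cG M.-1))).
by rewrite (lim_seriesZ _ (cG M)) (lim_seriesZ _ (cG M.-1)).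
Qed.

End fixed_parameters.
End bcp_mass_function.

(** * Expectations of functions of the number of successes *)

Section counting_expectation.
Context {R : realType} {I : finType} (p : I -> R).

Lemma expect_cnt_D1 (A : {set I}) i (u : nat -> R) : i \in A ->
  expect p (fun w => u (cnt A w)) =
  expect p (fun w => u (cnt (A :\ i) w)) +
  p i * expect p (fun w => u (cnt (A :\ i) w).+1 - u (cnt (A :\ i) w)).
Proof.
move=> Ai; rewrite (expect_upd p i) -expectZ -expectD; apply: eq_expect => w.
by rewrite !cnt_upd_in// add0n add1n; ring.
Qed.

(** W u(W - 1) is the sum of I_i u(W - 1), and W - 1 = W_i on the event I_i = 1. *)
Lemma expect_size_bias (u : nat -> R) :
  expect p (fun w => (cnt [set: I]%SET w)%:R * u (cnt [set: I]%SET w).-1) =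
  \sum_i p i * expect p (fun w => u (cnt (~: [set i])%SET w)).
Proof.
transitivity (expect p (fun w => \sum_i (w i)%:R * u (cnt [set: I]%SET w).-1)).
  apply: eq_expect => w; rewrite -mulr_suml -natr_sum; congr (_%:R * _).
  by apply: eq_bigl => i; rewrite inE.
rewrite expect_sum; apply: eq_bigr => i _.
rewrite (expect_upd p i) -expectZ; apply: eq_expect => w.
by rewrite !cnt_upd_in ?inE// !upd_same -finset.setTD add1n /=; ring.
Qed.

Definition count_mass (k : nat) : R :=
  expect p (fun w => (cnt [set: I]%SET w == k)%:R).

Lemma count_mass_large k : (#|I| < k)%N -> count_mass k = 0.
Proof.
move=> Ik; rewrite -[RHS](expect_cst p); apply: eq_expect => w.
case: eqP => // wk; exfalso; move: Ik; rewrite -wk ltnNge => /negP; apply.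
rewrite /cnt -sum1_card (eq_bigl predT) => [|i]; last by rewrite inE.
by apply: leq_sum => i _; case: (w i).
Qed.

Lemma sum_count_mass (u : nat -> R) :
  \sum_(0 <= k < #|I|.+1) count_mass k * u k =
  expect p (fun w => u (cnt [set: I]%SET w)).
Proof.
under eq_bigr do rewrite mulrC -expectZ.
rewrite -expect_sum; apply: eq_expect => w; rewrite big_mkord.
have wI : (cnt [set: I]%SET w < #|I|.+1)%N.
  rewrite ltnS /cnt -sum1_card (eq_bigl predT) => [|i]; last by rewrite inE.
  by apply: leq_sum => i _; case: (w i).
rewrite (bigD1 (Ordinal wI))//= eqxx mulr1 big1 ?addr0// => k.
rewrite -val_eqE /= => /negPf kw.
by rewrite eq_sym kw mulr0.
Qed.

End counting_expectation.

(** * The estimate for the mass functions *)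

Section main_estimate.
Local Open Scope classical_set_scope.
Context {R : realType} {I : finType} (p : I -> R).
Hypothesis p01 : forall i, 0 <= p i <= 1.

Local Notation S := (moment_sum p).
Let lam := \sum_i p i.
Local Notation v := (bernoulli_variance p).
Let sg := \sum_i v i.

Variables (tau delta : R) (M : nat).
Hypothesis v_tau : forall i, v i <= tau.
Hypothesis tau_lt : 3 * tau < sg.
Hypothesis lam_gt0 : 0 < lam.
Hypothesis S2_gt0 : 0 < S 2.
Hypothesis S3_gt0 : 0 < S 3.
Hypothesis delta_ge0 : 0 <= delta.
Hypothesis M_delta : M%:R + delta = S 2 ^+ 3 / S 3 ^+ 2.

Let P := S 3 / S 2.
Let al := lam - M%:R * P.
Hypothesis P_lt : P < 1 / 2.

Let EW (u : nat -> R) := expect p (fun w => u (cnt [set: I]%SET w)).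
Let EWi i (u : nat -> R) := expect p (fun w => u (cnt (~: [set i])%SET w)).
Let D1 (u : nat -> R) k := u k.+1 - u k.

Let P_gt0 : 0 < P. Proof. exact: divr_gt0. Qed.

(** [P] and M + delta are matched to two power sums: (M + delta) P^k = S k for k = 2 and k = 3. Only
    the rounding part delta remains. *)
Let MP2 : S 2 - M%:R * P ^+ 2 = delta * P ^+ 2.
Proof.
have -> : M%:R = S 2 ^+ 3 / S 3 ^+ 2 - delta by rewrite -M_delta addrK.
by rewrite /P; field; rewrite !gt_eqF.
Qed.

Let MP3 : S 3 - M%:R * P ^+ 3 = delta * P ^+ 3.
Proof.
have -> : M%:R = S 2 ^+ 3 / S 3 ^+ 2 - delta by rewrite -M_delta addrK.
by rewrite /P; field; rewrite !gt_eqF.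
Qed.

(** M P <= (M + delta) P = (S 2)^2 / S 3, which is at most S 1 by log-convexity. *)
Lemma bcp_alpha_ge0 : 0 <= al.
Proof.
rewrite subr_ge0; apply: (@le_trans _ _ ((M%:R + delta) * P)).
  by rewrite ler_wpM2r ?(ltW P_gt0)// lerDl.
rewrite M_delta (_ : _ * P = S 2 ^+ 2 / S 3); last first.
  by rewrite /P; field; rewrite !gt_eqF.
rewrite ler_pdivrMr//.
have lamE : lam = S 1 by apply: eq_bigr => i _; rewrite expr1.
by rewrite lamE; apply: sum_expr_log_convex => //; rewrite -/(S 1) -lamE.
Qed.

Let al_ge0 := bcp_alpha_ge0.

Let P_le1 : P <= 1. Proof. by move: P_lt; lra. Qed.

Let EW_EWi i u : EW u = EWi i u + p i * EWi i (D1 u).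
Proof. by rewrite /EW (expect_cnt_D1 p u (finset.in_setT i)) /EWi -finset.setTD. Qed.

Let b := bcp_mass al P M.
Let b_ge0 k : 0 <= b k.
Proof. by apply: bcp_mass_ge0 => //; exact: ltW. Qed.
Let b_cvg : series b @ \oo --> (1 : R).
Proof. by apply: bcp_mass_cvg => //; exact: ltW. Qed.
Let a := count_mass p.
Let dist := limn (series (fun k => `|a k - b k|)).

Let series_a (u : nat -> R) : cvgn (series (fun k => a k * u k)) /\
  limn (series (fun k => a k * u k)) = EW u.
Proof.
have [] := @limn_series_finite R (fun k => a k * u k) #|I|.+1.
  by move=> k kI; rewrite /a count_mass_large ?mul0r.
by rewrite sum_count_mass.
Qed.

Let series_b (u : nat -> R) C : (forall k, `|u k| <= C) ->
  cvgn (series (fun k => b k * u k)).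
Proof. by move=> uC; apply: is_cvg_mean uC => //; exact: cvgP b_cvg. Qed.

Let series_diff (u : nat -> R) C : (forall k, `|u k| <= C) ->
  cvgn (series (fun k => (a k - b k) * u k)) /\
  limn (series (fun k => (a k - b k) * u k)) = EW u - mean b u.
Proof.
move=> uC; have [ca la] := series_a u; have cb := series_b uC.
rewrite (_ : (fun k => (a k - b k) * u k) =
  (fun k => a k * u k) - (fun k => b k * u k)); last first.
  by apply/funext => k; rewrite mulrBl.
by split; [exact: is_cvg_seriesB|rewrite lim_seriesB// la].
Qed.

Let sign k := Num.sg (a k - b k).

Let sign_le1 k : `|sign k| <= 1.
Proof. by rewrite normr_sg; case: eqP. Qed.

Let absE : (fun k => `|a k - b k|) = (fun k => (a k - b k) * sign k).
Proof. by apply/funext => k; rewrite [LHS]normrEsg mulrC. Qed.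

Lemma count_bcp_cvg : cvgn (series (fun k => `|a k - b k|)).
Proof. by rewrite absE; have [] := series_diff sign_le1. Qed.

Let bound_functional (u : nat -> R) C : (forall k, `|u k| <= C) ->
  `|EW u - mean b u| <= C * dist.
Proof.
move=> uC; have [_ <-] := series_diff uC.
apply: norm_limn_series_le; first exact: count_bcp_cvg.
by move=> k; rewrite normrM mulrC ler_wpM2r.
Qed.

Let EW_bound u C : (forall k, `|u k| <= C) -> `|EW u| <= C.
Proof.
move=> uC; apply: le_trans (ler_norm_expect p01 _) _.
by rewrite -[leRHS](expect_cst p); exact: (ler_expect p01).
Qed.

Let D2E (u : nat -> R) k : D1 (D1 u) k = u k.+2 - 2 * u k.+1 + u k.
Proof. by rewrite /D1; ring. Qed.

Let bracket := 2 * S 4 / Num.sqrt ((sg - tau) * (sg - 3 * tau))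
     + 2 * M%:R * P ^+ 4 /
       ((1 - 2 * P) ^+ 2 * Num.sqrt sg * Num.sqrt (sg - tau))
     + (1 + 2 * P) * delta * P ^+ 2.

Let stein_identity : exists (d h : nat -> R),
  [/\ forall k, `|d k| <= 2 / lam, forall k, `|h k| <= 2 / lam / (1 - 2 * P),
     forall k, h k = d k - P * D1 h k &
     dist = (\sum_i p i ^+ 2 * EWi i d) - M%:R * P ^+ 2 * mean b h].
Proof.
have [c [G [B [GE GB GL]]]] := poisson_stein_solution lam_gt0
  (fun k => poisson_mass_gt0 k lam_gt0) (poisson_mass_recl lam)
  (poisson_mass_cvg lam) sign_le1.
have [H [B' [HE HB HL]]] := bounded_resolvent (ltW P_gt0) P_lt GB GL.
have HGE k : H k = G k - P * D1 H k by rewrite -HE /D1; ring.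
exists (D1 G), (D1 H); split => //.
  by move=> k; rewrite /D1 -!HE /D1; ring.
rewrite /dist absE; have [_ ->] := series_diff sign_le1.
have signE k : sign k = c + lam * G k - k%:R * G k.-1.
  by rewrite -addrA GE; ring.
have -> : EW sign = c + \sum_i p i ^+ 2 * EWi i (D1 G).
  rewrite /EW (eq_expect p (G := fun w => c + lam * G (cnt [set: I]%SET w) -
     (cnt [set: I]%SET w)%:R * G (cnt [set: I]%SET w).-1)) => [|w]; last first.
    by rewrite signE.
  rewrite expectB expectD expect_cst expectZ expect_size_bias -addrA.
  congr (_ + _); rewrite mulr_suml -sumrB; apply: eq_bigr => i _.
  rewrite -/(EW G) -/(EWi i G) (EW_EWi i G); ring.
suff -> : mean b sign = c + M%:R * P ^+ 2 * mean b (D1 H) by ring.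
have cb : cvgn (series b) by exact: cvgP b_cvg.
have cG := series_b GB; have cH := series_b HB.
have cst_G := bcp_stein al_ge0 (ltW P_gt0) P_le1 (M := M) GB HB HE.
have e1 : mean b sign = c + lam * mean b G -
    (al * mean b G + M%:R * P * mean b H).
  rewrite /mean -/b.
  rewrite (_ : (fun k => b k * sign k) = (c *: b + lam *: (fun k => b k * G k)) -
     (fun k => b k * (k%:R * G k.-1))); last first.
    apply/funext => k; rewrite signE.
    rewrite (_ : (_ - _) k = c * b k + lam * (b k * G k) - b k * (k%:R * G k.-1))//.
    by ring.
  rewrite lim_seriesB; last 2 first.
  - by apply: is_cvg_seriesD; exact: is_cvg_seriesZ.
  - exact: cvgP cst_G.
  rewrite (lim_seriesD (is_cvg_seriesZ cb) (is_cvg_seriesZ cG)).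
  rewrite (lim_seriesZ _ cb) (lim_seriesZ _ cG) (cvg_lim _ cst_G)//.
  by rewrite (cvg_lim _ b_cvg)// /GRing.scale /= mulr1.
rewrite e1.
(* As lam - al = M P, the difference E G(Y) - E H(Y) = P E D H(Y) leaves exactly the term M P^2 E D
   H(Y). *)
have e2 : mean b G = mean b H + P * mean b (D1 H).
  have cD : cvgn (series (fun k => b k * D1 H k)) by exact: series_b HL.
  rewrite /mean -[P * _](lim_seriesZ P cD) -(lim_seriesD cH (is_cvg_seriesZ cD)).
  apply: eq_limn_series => k.
  rewrite (_ : (_ + _) k = b k * H k + P * (b k * D1 H k))//.
  by rewrite HGE /D1; ring.
rewrite /al e2; ring.
Qed.

(** [EW_EWi] and the equation for [h] are each applied twice. The coefficients of E d(W) and E D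
    d(W) are then those of [MP2] and [MP3]. *)
Let expansion (d h : nat -> R) : (forall k, h k = d k - P * D1 h k) ->
  (\sum_i p i ^+ 2 * EWi i d) - M%:R * P ^+ 2 * EW h =
  delta * P ^+ 2 * EW d - delta * P ^+ 3 * EW (D1 d)
  + \sum_i p i ^+ 4 * EWi i (D1 (D1 d)) - M%:R * P ^+ 4 * EW (D1 (D1 h)).
Proof.
move=> hE.
have -> : \sum_i p i ^+ 2 * EWi i d = S 2 * EW d - S 3 * EW (D1 d) +
    \sum_i p i ^+ 4 * EWi i (D1 (D1 d)).
  rewrite !mulr_suml -sumrB -big_split; apply: eq_bigr => i _ /=.
  by rewrite (EW_EWi i d) (EW_EWi i (D1 d)); ring.
have -> : EW h = EW d - P * EW (D1 d) + P ^+ 2 * EW (D1 (D1 h)).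
  have dE k : d k = h k + P * D1 h k by rewrite {1}hE; ring.
  rewrite /EW -!expectZ -expectB -expectD; apply: eq_expect => w.
  by rewrite /D1 !dE /D1; ring.
rewrite -MP2 -MP3; ring.
Qed.

Lemma count_bcp_distance (theta : R) :
  M%:R * P ^+ 2 / ((1 - 2 * P) ^+ 2 * lam) = theta -> theta < 1 / 2 ->
  dist <= 2 / ((1 - 2 * theta) * lam) * bracket.
Proof.
move=> thetaE theta_lt.
have [d [h [dB hB hE distE]]] := stein_identity.
have e0 : 0 < 1 - 2 * P by move: P_lt; lra.
have L0 : 0 < 2 / lam by exact: divr_gt0.
have dist0 : 0 <= dist.
  have /bound_functional : forall k : nat, `|(fun=> 0) k : R| <= 1.
    by move=> k; rewrite normr0.
  by rewrite mul1r; apply: le_trans; exact: normr_ge0.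
have ratio : 2 * S 3 < S 2.
  by move: P_lt; rewrite ltr_pdivrMr//; lra.
have D1B k : `|D1 d k| <= 2 * (2 / lam).
  by apply: le_trans (ler_normB _ _) _; have := dB k; have := dB k.+1; lra.
have tau0 : 0 <= tau by exact: (variance_bound_ge0 p01 v_tau S2_gt0).
have sqrtg_neq0 : Num.sqrt sg != 0.
  by rewrite gt_eqF// sqrtr_gt0; move: tau0 tau_lt; lra.
have sqrtt_neq0 : Num.sqrt (sg - tau) != 0.
  by rewrite gt_eqF// sqrtr_gt0; move: tau0 tau_lt; lra.
set Q1 := Num.sqrt ((sg - tau) * (sg - 3 * tau)).
set Q2 := Num.sqrt sg * Num.sqrt (sg - tau).
have t1 : `|EW d| <= 2 / lam by exact: EW_bound.
have t2 : `|EW (D1 d)| <= 2 * (2 / lam) by exact: EW_bound.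
have t3 : `|\sum_i p i ^+ 4 * EWi i (D1 (D1 d))| <= S 4 * (2 / lam * (2 / Q1)).
  apply: le_trans (ler_norm_sum _ _ _) _; rewrite mulr_suml; apply: ler_sum => i _.
  have /andP[pi0 _] := p01 i.
  rewrite normrM ger0_norm ?exprn_ge0// ler_wpM2l ?exprn_ge0//.
  rewrite /EWi (eq_expect p (fun w => D2E d _)).
  exact: (second_difference_punctured p01 v_tau tau_lt S2_gt0 ratio i dB).
(* One factor 1 / (1 - 2 P) comes from the sup bound on [h], the other from
   [second_difference_full]. *)
have t4 : `|EW (D1 (D1 h))| <= 2 / lam * (2 / ((1 - 2 * P) ^+ 2 * Q2)).
  have := second_difference_full p01 v_tau tau_lt S2_gt0 ratio hB.
  rewrite -/(S 3) -/(S 2) -/P -/sg -/Q2 /EW (eq_expect p (fun w => D2E h _)) => h1.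
  rewrite -(ler_pM2l e0); apply: le_trans h1 _.
  rewrite le_eqVlt; apply/orP; left; apply/eqP.
  by field; rewrite ?mulf_neq0 ?sqrtg_neq0 ?sqrtt_neq0 ?gt_eqF.
have t5 := bound_functional hB.
have key : dist <= 2 / lam * bracket +
    M%:R * P ^+ 2 * (2 / lam / (1 - 2 * P)) * dist.
  rewrite {1}distE (_ : _ - _ = ((\sum_i p i ^+ 2 * EWi i d) - M%:R * P ^+ 2 * EW h)
    + M%:R * P ^+ 2 * (EW h - mean b h)); last by ring.
  rewrite expansion//.
  have m2 : 0 <= M%:R * P ^+ 2 by rewrite mulr_ge0 ?exprn_ge0// ltW.
  have m4 : 0 <= M%:R * P ^+ 4 by rewrite mulr_ge0 ?exprn_ge0// ltW.
  have d2 : 0 <= delta * P ^+ 2 by rewrite mulr_ge0 ?exprn_ge0// ltW.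
  have d3 : 0 <= delta * P ^+ 3 by rewrite mulr_ge0 ?exprn_ge0// ltW.
  apply: lerD; last first.
    by rewrite -[leRHS]mulrA ler_wpM2l//; apply: le_trans (ler_norm _) t5.
  (* Bounding D d by twice the bound on d makes the two delta terms combine into (1 + 2 P) delta
     P^2. *)
  have -> : 2 / lam * bracket = delta * P ^+ 2 * (2 / lam) +
     delta * P ^+ 3 * (2 * (2 / lam)) + S 4 * (2 / lam * (2 / Q1)) +
     M%:R * P ^+ 4 * (2 / lam * (2 / ((1 - 2 * P) ^+ 2 * Q2))).
    rewrite /bracket -/Q1 -[(1 - 2 * P) ^+ 2 * _ * _]mulrA -/Q2; ring.
  apply: lerD; first apply: lerD; first apply: lerD.
  - by rewrite ler_wpM2l// (le_trans (ler_norm _)).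
  - by rewrite -mulrN ler_wpM2l// (le_trans _ t2)// -normrN ler_norm.
  - by rewrite (le_trans (ler_norm _)).
  - by rewrite -mulrN ler_wpM2l// (le_trans _ t4)// -normrN ler_norm.
(* The exact coefficient is (1 - 2 P) 2 theta; the factor 1 - 2 P <= 1 is given away. *)
have theta_le : M%:R * P ^+ 2 * (2 / lam / (1 - 2 * P)) <= 2 * theta.
  have -> : M%:R * P ^+ 2 * (2 / lam / (1 - 2 * P)) = (1 - 2 * P) * (2 * theta).
    by rewrite -thetaE; field; rewrite !gt_eqF.
  apply: ler_piMl; last by move: P_gt0; lra.
  rewrite -thetaE mulr_ge0//.
  by apply: divr_ge0; apply: mulr_ge0; rewrite ?exprn_ge0 ?ler0n// ltW.
have th0 : 0 < 1 - 2 * theta by move: theta_lt; lra.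
have : (1 - 2 * theta) * dist <= 2 / lam * bracket.
  by have := ler_wpM2r dist0 theta_le; move: key; lra.
rewrite mulrC -ler_pdivlMr// => /le_trans; apply.
by rewrite le_eqVlt; apply/orP; left; apply/eqP; field; rewrite !gt_eqF.
Qed.

End main_estimate.

(** * Laws on the integers and their mass functions *)

Section laws.
Context {R : realType}.
Local Open Scope classical_set_scope.

(** Rate 0 is a separate case, a Dirac mass at 0; the mass formula agrees with it since 0^0 = 1. *)
Lemma poisson_prob_set1 (al : R) (j k : nat) : 0 <= al ->
  poisson_prob al j [set k] = (poisson_mass al k)%:E.
Proof.
rewrite le_eqVlt /poisson_prob => /predU1P[<-|al0].
  rewrite ltxx diracE /poisson_mass /exp_coeff /= oppr0 expR0 mul1r.
  case: k => [|k]; first by rewrite mem_set// expr0 fact0 divr1.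
  by rewrite memNset// expr0n mul0r.
rewrite al0 esum_set1 ?lee_fin ?poisson_pmf_ge0// /poisson_pmf al0.
by rewrite /poisson_mass /exp_coeff /= mulrC.
Qed.

Lemma binomial_prob_set1 (M : nat) (p : R) (k : nat) : 0 <= p <= 1 ->
  binomial_prob M p [set k] = (binomial_pmf M p k)%:E.
Proof.
by move=> p01; rewrite /binomial_prob p01 esum_set1 ?lee_fin ?binomial_pmf_ge0.
Qed.

Lemma binomial_pmf0 (M : nat) (p : R) :
  binomial_pmf M.+1 p 0 = (1 - p) * binomial_pmf M p 0.
Proof. by rewrite /binomial_pmf !expr0 !mul1r !bin0 !subn0 !mulr1n exprS. Qed.

Lemma binomial_pmfS (M : nat) (p : R) (k : nat) :
  binomial_pmf M.+1 p k.+1 =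
  (1 - p) * binomial_pmf M p k.+1 + p * binomial_pmf M p k.
Proof.
rewrite /binomial_pmf binS subSS exprS mulrnDr.
set q := unstable.onem p.
have -> : 1 - p = q by [].
have [kM|kM] := ltnP k M; last by rewrite (@bin_small M k.+1)// !mulr0n; ring.
by rewrite -(subnSK kM) exprS; ring.
Qed.

(** Induction on M, with Pascal's rule in the form [binomial_pmfS]. *)
Lemma bcp_mass_convolution (al p : R) (M k : nat) :
  bcp_mass al p M k =
  \sum_(j < k.+1) poisson_mass al (k - j)%N * binomial_pmf M p j.
Proof.
elim: M k => [|M IH] k.
  rewrite big_ord_recl big1 ?addr0 => [|j _]; last first.
    by rewrite /binomial_pmf bin0n mulr0n mulr0.
  rewrite /binomial_pmf bin0 mulr1n.
  by rewrite /= !subn0 !expr0 !mulr1.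
rewrite /= IH big_ord_recl [in RHS]big_ord_recl /= binomial_pmf0.
case: k => [|k].
  by rewrite !big_ord0 !addr0; ring.
rewrite IH.
under [X in _ = _ + X]eq_bigr => j _ do
  rewrite /bump /= add1n subSS binomial_pmfS mulrDr mulrCA [_ * (p * _)]mulrCA.
rewrite big_split/= -!mulr_sumr.
by under eq_bigr => j _ do rewrite /bump /= add1n subSS; ring.
Qed.

Lemma bcp_set1 (al p : R) (M k : nat) : 0 <= al -> 0 <= p <= 1 ->
  bcp al M p [set k%:Z] = (bcp_mass al p M k)%:E.
Proof.
move=> al0 p01; rewrite /bcp /distribution /pushforward /=.
rewrite (_ : nat_pair_sum @^-1` _ =
    \big[setU/set0]_(j < k.+1) ([set (k - j)%N] `*` [set (j : nat)])); last first.
  rewrite -bigcup_seq; apply/seteqP; split=> [[y1 y2]/=|[y1 y2]/= [j _ [/= -> ->]]].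
    move=> [yk]; have y2k : (y2 < k.+1)%N by rewrite -yk ltnS leq_addl.
    by exists (Ordinal y2k); rewrite /= ?mem_index_enum// -yk addnK.
  by rewrite /nat_pair_sum /= subnK// -ltnS.
rewrite measure_bigsetU_ord; last 2 first.
- by move=> i; exact: measurableX.
- move=> i j _ _ [[y1 y2] /= [[_ yi] [_ yj]]].
  by apply/val_inj; rewrite /= -yi -yj.
rewrite bcp_mass_convolution -sumEFin; apply: eq_bigr => j _.
apply: etrans; first by apply: product_measure1E.
by rewrite EFinM -(poisson_prob_set1 0 _ al0) -binomial_prob_set1.
Qed.

Lemma bcp_set1_neg (al p : R) (M k : nat) : bcp al M p [set Negz k] = 0%E.
Proof.
rewrite /bcp /distribution /pushforward /= (_ : _ @^-1` _ = set0) ?measure0//.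
by apply/seteqP; split=> [[y1 y2]|].
Qed.

Section indicator_law.
Context (d : measure_display) (T : measurableType d) (P : probability T R)
  (n : nat) (ps : 'I_n -> R) (X : 'I_n -> {RV P >-> bool}).
Hypothesis ps01 : forall i, 0 <= ps i <= 1.
Hypothesis X_bernoulli : forall i, distribution P (X i) = bernoulli_prob (ps i).
Hypothesis X_indep : mutually_independent X.

(** The intersection runs over the full finite set so that [mutually_independent] applies to it
    verbatim. *)
Let atom (w : {ffun 'I_n -> bool}) : set T :=
  \bigcap_(i in [set i | i \in [set: 'I_n]%SET]) (X i @^-1` [set w i]).

Let P_atom w : P (atom w) = (weight ps w)%:E.
Proof.
rewrite X_indep// -prodEFin.
rewrite (eq_bigl predT) => [|i]; last by rewrite inE.
apply: eq_bigr => i _.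
have -> : P (X i @^-1` [set w i]) = distribution P (X i) [set w i] by [].
rewrite X_bernoulli /bernoulli_prob ps01 fsbig_set1 /bernoulli_pmf.
by case: (w i).
Qed.

Let measurable_atom w : measurable (atom w).
Proof.
apply: fin_bigcap_measurable => // i _.
by rewrite -[X in measurable X]setTI; apply: measurable_funP.
Qed.

Lemma indicator_sum_set1 (k : nat) :
  distribution P (indicator_sum X) [set k%:Z] = (count_mass ps k)%:E.
Proof.
rewrite /distribution /pushforward /=.
rewrite (_ : indicator_sum X @^-1` _ =
    \bigcup_(w in [set w | cnt [set: 'I_n]%SET w == k]) atom w); last first.
  apply/seteqP; split=> [t /= [tk]|t /= [w /= /eqP wk wt]].
    exists [ffun i => X i t] => [/=|i _ /=]; last by rewrite ffunE.
    apply/eqP; rewrite -tk; apply: eq_big => [i|i _]; first by rewrite inE.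
    by rewrite ffunE.
  rewrite /indicator_sum; congr Posz; rewrite -wk.
  by apply: eq_big => [i|i _]; rewrite ?inE// (wt i)//= inE.
rewrite measure_fin_bigcup; last 3 first.
- exact: finite_finset.
- move=> w1 w2 _ _ [t [t1 t2]]; apply/ffunP => i.
  have -> : w1 i = X i t by rewrite (t1 i)//= inE.
  by rewrite (t2 i)//= inE.
- by move=> w _; exact: measurable_atom.
rewrite (eq_fsbigr (fun w => (weight ps w)%:E)) => [|w _]; last exact: P_atom.
rewrite fsbig_mkcond /count_mass /expect -sumEFin.
rewrite [RHS]fsbig_seq ?index_enum_uniq//.
have -> : [set` index_enum {ffun 'I_n -> bool}] = [set: {ffun 'I_n -> bool}].
  by apply/seteqP; split => w //= _; rewrite mem_index_enum.
apply: eq_fsbigr => w _; rewrite patchE; case: ifPn => wk.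
  by move: wk; rewrite inE /= => ->; rewrite mulr1.
by move: wk; rewrite notin_setE /= => /negP/negPf ->; rewrite mulr0.
Qed.

Lemma indicator_sum_set1_neg (k : nat) :
  distribution P (indicator_sum X) [set Negz k] = 0%E.
Proof.
rewrite /distribution /pushforward (_ : _ @^-1` _ = set0) ?measure0//.
by apply/seteqP; split=> [t|].
Qed.

End indicator_law.

(** Neither law charges the negative integers, so the sum over the integers restricts to the image
    of [Posz] and becomes a real series. *)
Lemma tv_norm_nat (mu1 mu2 : probability int R) (a b : R^nat) :
  (forall k, mu1 [set k%:Z] = (a k)%:E) -> (forall k, mu2 [set k%:Z] = (b k)%:E) ->
  (forall k, mu1 [set Negz k] = 0%E) -> (forall k, mu2 [set Negz k] = 0%E) ->
  cvgn (series (fun k => `|a k - b k|)) ->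
  tv_norm (prob_diff mu1 mu2) = (limn (series (fun k => `|a k - b k|)))%:E.
Proof.
move=> ma mb ma0 mb0 cab; rewrite /tv_norm.
have diffE z : prob_diff mu1 mu2 [set z] = (mu1 [set z] - mu2 [set z])%E.
  by rewrite /prob_diff /cadd /copp /= /charge_of_finite_measure.
rewrite (esumID (range Posz))//.
rewrite [X in (_ + X)%E]esum1 => [|[z|z] [_ zn]]; last 2 first.
- by exfalso; apply: zn; exists z.
- by rewrite diffE ma0 mb0 sube0 abse0.
rewrite adde0 setTI esum_image; last by move=> x y _ _ [].
rewrite -nneseries_esumT => [|k]; last exact: abse_ge0.
rewrite -EFin_lim//; apply/congr_lim/funext => k; rewrite /= /series /= -sumEFin.
by apply: eq_bigr => j _; rewrite diffE ma mb.
Qed.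

End laws.

(** * From the mass functions to the laws *)

Local Open Scope classical_set_scope.

Theorem corollary4p2 (R : realType) (d : measure_display)
    (T : measurableType d) (P : probability T R) (n : nat)
    (ps : 'I_n -> R) (X : 'I_n -> {RV P >-> bool})
    (ps01 : forall i, 0 <= ps i <= 1)
    (ps_neq0 : exists i, ps i != 0)
    (X_bernoulli : forall i, distribution P (X i) = bernoulli_prob (ps i))
    (X_indep : mutually_independent X) :
  let M := bcp_M ps in
  let delta := bcp_delta ps in
  let p := bcp_p ps in
  let alpha := bcp_alpha ps in
  let sigma := Num.sqrt (sigma2 ps) in
  let tau := tau ps in
  let theta1 := theta1 ps in
  Num.max p theta1 < 1 / 2 ->
  sigma2 ps > 3 * tau ->
  (tv_norm (prob_diff (distribution P (indicator_sum X)) (bcp alpha M p)) <=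
   (2 / ((1 - 2 * theta1) * lambda_hat ps) *
    (2 * (\sum_(i < n) ps i ^+ 4) /
       Num.sqrt ((sigma2 ps - tau) * (sigma2 ps - 3 * tau))
     + 2 * M%:R * p ^+ 4 /
       ((1 - 2 * p) ^+ 2 * sigma * Num.sqrt (sigma2 ps - tau))
     + (1 + 2 * p) * delta * p ^+ 2))%:E)%E.
Proof.
move=> M delta p alpha sigma tau theta1.
rewrite gt_max => /andP[p_lt theta_lt] tau_lt.
have ps0 i : 0 <= ps i by have /andP[] := ps01 i.
have S_gt0 k : 0 < power_sum ps k.
  have [i psi] := ps_neq0; apply: (lt_le_trans (y := ps i ^+ k)).
    by rewrite exprn_gt0// lt0r psi ps0.
  by rewrite /power_sum (bigD1 i)//= lerDl sumr_ge0// => j _; rewrite exprn_ge0.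
have lamE : lambda_hat ps = power_sum ps 1.
  by apply: eq_bigr => i _; rewrite expr1.
have lam_gt0 : 0 < lambda_hat ps by rewrite lamE.
have v_tau i : ps i * (1 - ps i) <= tau by apply: le_bigmax.
have delta_ge0 : 0 <= delta.
  rewrite subr_ge0 truncn_le// divr_ge0// exprn_ge0// ltW//.
have M_delta : M%:R + delta = power_sum ps 2 ^+ 3 / power_sum ps 3 ^+ 2.
  by rewrite /delta /bcp_delta addrC subrK.
have thetaE : M%:R * p ^+ 2 / ((1 - 2 * p) ^+ 2 * lambda_hat ps) = theta1.
  have -> : lambda_hat ps = M%:R * p + alpha by rewrite addrC subrK.
  by [].
have p01 : 0 <= p <= 1.
  by rewrite divr_ge0 ?(ltW (S_gt0 _))//=; move: p_lt; lra.
have alpha0 : 0 <= alpha.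
  exact: (bcp_alpha_ge0 ps01 lam_gt0 (S_gt0 2) (S_gt0 3) delta_ge0 M_delta).
rewrite (tv_norm_nat (a := count_mass ps) (b := bcp_mass alpha p M)).
- rewrite lee_fin.
  exact: (count_bcp_distance ps01 v_tau tau_lt lam_gt0 (S_gt0 2) (S_gt0 3)
    delta_ge0 M_delta p_lt thetaE theta_lt).
- by move=> k; exact: indicator_sum_set1.
- by move=> k; exact: bcp_set1.
- by move=> k; exact: indicator_sum_set1_neg.
- by move=> k; exact: bcp_set1_neg.
- exact: (count_bcp_cvg ps01 lam_gt0 (S_gt0 2) (S_gt0 3) delta_ge0 M_delta
    p_lt).
Qed.
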